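(* Let $P,Q,N>0$ and $\sigma_u^2\ge0$, and consider the Gaussian state amplification channel with noisy state observations with these parameters (see context). Put $$\lambda=\frac{Q}{Q+\sigma_u^2},\qquad Q'=\frac{Q^2}{Q+\sigma_u^2},\qquad N'=\frac{Q\sigma_u^2}{Q+\sigma_u^2},$$ and define, for $x\in[0,Q']$, $$f(x)=\left(\max\left\{\sqrt{x}-\sqrt{N'/Q'}\,\sqrt{Q'-x},\,0\right\}\right)^2 .$$ If a rate--state-distortion pair $(R,D)$ with $R\ge0$ is achievable, then there exists $\bar r\in\left[0,\sqrt{P(Q+\sigma_u^2)}\right]$ such that $$R\le\frac12\log_2\frac{\sigma_u^2(N+P+Q)+Q(N+P)-\bar r^2}{(Q+\sigma_u^2)(N+N')}$$ and $$D\ge f\left(\frac{Q'(N+N')}{P+Q+N+2\lambda\bar r}\,2^{2R}\right).$$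
   Context: Channel model. For $i=1,2,\dots$ the channel output is $Y_i=X_i+S_i+Z_i$, where $X_i\in\mathbb R$ is the channel input, $S_i\sim\mathrm N(0,Q)$ i.i.d. is the state, and $Z_i\sim\mathrm N(0,N)$ i.i.d. is the noise. The sender observes noncausally (the whole block in advance) the sequence $V_i=S_i+U_i$, where $U_i\sim\mathrm N(0,\sigma_u^2)$ i.i.d. The sequences $\{S_i\},\{Z_i\},\{U_i\}$ are mutually independent. Codes. A $(2^{nR},n)$ code consists of an encoder (measurable map) sending a message $m\in\{1,\dots,2^{\lceil nR\rceil}\}$ and an observation $v^n\in\mathbb R^n$ to an input sequence $x^n\in\mathbb R^n$, and a decoder (measurable map) sending $y^n\in\mathbb R^n$ to a message estimate $\hat m\in\{1,\dots,2^{\lceil nR\rceil}\}$ and a state estimate $\hat s^n\in\mathbb R^n$. The message $M$ is uniformly distributed on the message set and independent of $(S^n,U^n,Z^n)$. Only codes satisfying the average power constraint $\frac1n\sum_{i=1}^n\mathsf E[X_i^2]\le P$ are considered. Achievability. A pair $(R,D)$ is achievable if there is a sequence of $(2^{nR},n)$ codes with $\lim_{n\to\infty}\mathsf P\{\hat M\ne M\}=0$ and $\limsup_{n\to\infty}\frac1n\sum_{i=1}^n\mathsf E\left[(S_i-\hat S_i)^2\right]\le D$. Remark on domain. The stated bound on $R$ implies that the argument of $f$ in the bound on $D$ lies in $[0,Q']$ (since $N'\le Q$), so the bound on $D$ is well defined. *)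

(* Defs.v *)
From HB Require Import structures.
From mathcomp Require Import all_boot all_order all_algebra.
From mathcomp Require Import all_classical all_reals all_analysis.

Set Implicit Arguments.
Unset Strict Implicit.
Unset Printing Implicit Defensive.

Import Order.TTheory GRing.Theory Num.Theory.
Import numFieldNormedType.Exports.

Local Open Scope classical_set_scope.
Local Open Scope ring_scope.

(* The law N(m, v), with v the variance.  [normal_prob] takes the standard
   deviation and does not denote the point mass when it is 0. *)
Definition gaussian {R : realType} (m v : R) : set R -> \bar R :=
  fun A => if v == 0 then (\d_m A)%E else normal_prob m (Num.sqrt v) A.

Section Independence.
Context {d : measure_display} {Omega : measurableType d} {R : realType}.
Variable Pr : probability Omega R.

(* Mutual independence of a family of set systems. *)
Definition independent {I : eqType} (F : I -> set (set Omega)) : Prop :=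
  forall (J : seq I) (A : I -> set Omega), uniq J ->
    (forall i, i \in J -> F i (A i)) ->
    (Pr (\bigcap_(i in [set` J]) A i) = \prod_(i <- J) Pr (A i))%E.

Definition sigma_rv d' (T : measurableType d') (X : Omega -> T) :
    set (set Omega) :=
  preimage_set_system setT X measurable.

Definition sigma_seq (X : nat -> Omega -> R) : set (set Omega) :=
  <<s \bigcup_i sigma_rv (X i) >>.

Definition iid_gaussian (v : R) (X : nat -> {RV Pr >-> R}) : Prop :=
  (forall i (A : set R), measurable A -> distribution Pr (X i) A = gaussian 0 v A)
  /\ independent (fun i => sigma_rv (X i)).

End Independence.

Section Channel.
Context {d : measure_display} {Omega : measurableType d} {R : realType}.
Variable Pr : probability Omega R.
Variables S U Z : nat -> {RV Pr >-> R}.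

(* State S, observation noise U (the sender sees S + U) and channel noise Z, of
   variances Q, su2 = sigma_u^2 and N.  Time indices start at 0. *)
Definition gaussian_channel (Q N su2 : R) : Prop :=
  [/\ iid_gaussian Q S, iid_gaussian N Z, iid_gaussian su2 U &
      independent Pr (tnth [tuple sigma_seq S; sigma_seq Z; sigma_seq U])].

Definition block n (X : nat -> Omega -> R) (w : Omega) : n.-tuple R :=
  [tuple X i w | i < n].

(* For r >= 0 the ceiling is nonnegative, hence unchanged by [absz]. *)
Definition msg_count (r : R) (n : nat) : nat :=
  (2 ^ `|Num.ceil (n%:R * r)|)%N.

(* The sigma-algebra on the finite message set is the discrete one. *)
Definition uniform_message n k (M : Omega -> 'I_k) : Prop :=
  [/\ forall E : set 'I_k, measurable (M @^-1` E),
      forall m : 'I_k, Pr (M @^-1` [set m]) = (k%:R^-1)%:E &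
      independent Pr (tnth [tuple
        preimage_set_system setT M setT;
        sigma_rv (fun w => (block n S w, block n U w, block n Z w))])].

Record code (n k : nat) := Code {
  enc : 'I_k -> n.-tuple R -> n.-tuple R;
  dec_msg : n.-tuple R -> 'I_k;
  dec_state : n.-tuple R -> n.-tuple R;
  enc_measurable : forall m, measurable_fun setT (enc m);
  dec_msg_measurable : forall E : set 'I_k, measurable (dec_msg @^-1` E);
  dec_state_measurable : measurable_fun setT dec_state }.

Section Performance.
Variables (n k : nat) (c : code n k) (M : Omega -> 'I_k).

Definition obs_block : Omega -> n.-tuple R :=
  block n (fun i w => S i w + U i w).

Definition input (w : Omega) : n.-tuple R := enc c (M w) (obs_block w).

Definition output (w : Omega) : n.-tuple R :=
  [tuple tnth (input w) i + S i w + Z i w | i < n].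

Definition error_prob : \bar R :=
  Pr [set w | dec_msg c (output w) <> M w].

Definition avg_power : \bar R :=
  ((n%:R^-1)%:E * \sum_(i < n) 'E_Pr[fun w => (tnth (input w) i ^+ 2)%R])%E.

Definition avg_distortion : \bar R :=
  ((n%:R^-1)%:E *
   \sum_(i < n)
     'E_Pr[fun w => ((S i w - tnth (dec_state c (output w)) i) ^+ 2)%R])%E.

End Performance.

(* [M n] is the message sent with block length [n].  The term n = 0 is
   irrelevant: all the averages over an empty block are 0. *)
Definition achievable (P r : R) (M : forall n, Omega -> 'I_(msg_count r n))
    (D : R) : Prop :=
  exists c : forall n, code n (msg_count r n),
    [/\ forall n, (avg_power (c n) (M n) <= P%:E)%E,
        error_prob (c n) (M n) @[n --> \oo] --> 0%E &
        (limn_esup (fun n => avg_distortion (c n) (M n)) <= D%:E)%E].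

End Channel.

(* Only meaningful for 0 <= x <= Q'; outside, [Num.sqrt] truncates to 0. *)
Definition distortion_bound {R : realType} (Q' N' x : R) : R :=
  (Num.max (Num.sqrt x - Num.sqrt (N' / Q') * Num.sqrt (Q' - x)) 0) ^+ 2.

Definition log2 {R : realType} (x : R) : R := ln x / ln 2.

(* Main.v *)
(* Let V = S + U be the observation, lam V the best linear estimate of S from V,
   T = S + Z - lam V the residual noise, of variance nu = N + N' and independent
   of V and of the message, so that Y = X + lam V + T.

   Both bounds come from a change of measure instead of mutual informations.
   Multiply the likelihood ratio "reference law of Y / law of T" by the payoff k
   when the message is correctly decoded and, for the bound on D, by the ratio
   "N(0, dv) density at V - b Shat / law of V".  The resulting Z satisfies
   E Z <= 2, because under the reference law Y is independent of the message, and
   of V in the second case.  As 1 + u <= exp u, this gives E ln Z <= ln 2.  Now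
   ln Z is a quadratic form plus ln k times the indicator of correct decoding, so
   only second moments are involved: E ln Z <= ln 2 reads

     (1 - Pe) ln k - ln 2 <= n/2 ln ((P + nu - rb^2 / (Q + su2)) / nu),
     (1 - Pe) ln k - ln 2 <= n/2 ln (dv tau / ((Q + su2) nu)),

   with rb the average of E[X_i V_i] and tau = P + Q + N + 2 lam rb.  The first
   bound limits rb from above by a quantity converging to rbar, chosen so that
   the bound on R is an equality; tau is increasing in rb, so rbar can be put in
   the second bound. *)

Require Import Defs.
From HB Require Import structures.
From mathcomp Require Import all_boot all_order all_algebra.
From mathcomp Require Import all_classical all_reals all_analysis.
From mathcomp Require Import measurable_realfun ring lra.
Import Order.TTheory GRing.Theory Num.Theory.
Import numFieldNormedType.Exports.
Local Open Scope classical_set_scope.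
Local Open Scope ring_scope.

Set Implicit Arguments.
Unset Strict Implicit.
Unset Printing Implicit Defensive.

(** * Gaussian integrals on the line *)

(** The second ratio integrates to 1 because the decoder sees Y alone: for fixed y the estimate is a
    constant vector, so V - b Shat is a translate of V, however nonlinear the decoder. The factor b
    is there because the distortion constrains S - Shat, whereas the change of measure speaks of V.
    Splitting V - b Shat as (V - b S) + b (S - Shat) bounds its second moment by dv for every b, and
    the optimum over b, taken only after the limit in n, is what produces f. Keeping b and the
    weight eta of Young's inequality as free parameters leaves the bound linear in second moments,
    so that it can be averaged over the letters. The reference laws are Gaussian, with the variance
    that the power constraint allows: Y centred at its best linear prediction from V for the rate, Y
    centred at 0 for the distortion. If su2 = 0, then N' = 0 and some laws are point masses;
    densities are only taken at positive variances, such as nu. The value D = 0 is reached as a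
    limit of D + e. *)

Section Translation.
Context {R : realType}.
Local Notation mu := (@lebesgue_measure R).
Implicit Types (c : R) (F : R -> \bar R).

Lemma lebesgue_measure_shift c (A : set R) : measurable A ->
  pushforward mu ((fun x => x + c) : _ -> measurableTypeR R) A = mu A.
Proof.
move=> mA.
have mf : measurable_fun [set: measurableTypeR R]
   ((fun x => x + c) : _ -> measurableTypeR R) by exact: measurable_funD.
apply/esym/lebesgue_measure_unique => //= _ [[a b]] _ <-.
rewrite /pushforward /=.
rewrite (_ : _ @^-1` _ = `]a - c, b - c]%classic); last first.
  by apply/seteqP; split=> x /=; rewrite !in_itv/= ltrBlDr lerBrDr.
rewrite !lebesgue_measure_itv/= !lte_fin.
by rewrite ltrD2r; case: ifP => // _; rewrite -!EFinB; congr EFin; ring.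
Qed.

Lemma ge0_integral_shift c F : measurable_fun setT F -> (forall x, (0 <= F x)%E) ->
  (\int[mu]_x F ((x : R) + c)%R = \int[mu]_x F x)%E.
Proof.
move=> mF F0.
have mf : measurable_fun [set: measurableTypeR R]
   ((fun x => x + c) : _ -> measurableTypeR R) by exact: measurable_funD.
rewrite -(@ge0_integral_pushforward _ _ _ _ _ _ mf mu setT F)//.
by apply: eq_measure_integral => A mA _; exact: lebesgue_measure_shift.
Qed.

End Translation.

Section Density.
Context {R : realType}.
Local Notation mu := (@lebesgue_measure R).

(** Change of variables yields the integral against the Radon-Nikodym derivative, which equals
    [normal_pdf] almost everywhere since the two have the same integral over every measurable
    set. *)
Lemma ge0_integral_normal_prob (m s : R) (F : R -> \bar R) :
  measurable_fun setT F -> (forall x, (0 <= F x)%E) ->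
  (\int[normal_prob m s]_x F x = \int[mu]_x (F x * (normal_pdf m s x)%:E))%E.
Proof.
move=> mF F0.
have dom := normal_prob_dominates m s.
rewrite -(@Radon_Nikodym_SigmaFinite.change_of_variables _ _ _
  (normal_prob m s) mu dom F setT)//.
have mg : measurable_fun setT (fun x => (normal_pdf m s x)%:E).
  by apply/measurable_EFinP; exact: measurable_normal_pdf.
have mRN : measurable_fun setT (Radon_Nikodym_SigmaFinite.f (normal_prob m s) mu).
  exact: measurable_int (Radon_Nikodym_SigmaFinite.f_integrable dom).
apply: ge0_ae_eq_integral => //.
- exact: emeasurable_funM.
- exact: emeasurable_funM.
- by move=> x _; rewrite mule_ge0// Radon_Nikodym_SigmaFinite.f_ge0.
- by move=> x _; rewrite mule_ge0// lee_fin normal_pdf_ge0.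
- apply: ae_eqe_mul2l; apply: integral_ae_eq => //.
    exact: Radon_Nikodym_SigmaFinite.f_integrable.
  by move=> A _ mA; rewrite -Radon_Nikodym_SigmaFinite.f_integral.
Qed.

End Density.

(* [normal_prob] lives on [measurableTypeR R], whose display is not the one of
   the canonical measurable structure of [R]. *)
Definition idR {R : realType} : measurableTypeR R -> R := idfun.
Lemma measurable_idR {R : realType} : measurable_fun setT (@idR R).
Proof. exact: measurable_id. Qed.
HB.instance Definition _ (R : realType) :=
  isMeasurableFun.Build _ _ _ _ (@idR R) measurable_idR.

Section Gaussian.
Context {R : realType}.
Local Notation mu := (@lebesgue_measure R).
Implicit Types (a b c v x y : R) (F : R -> \bar R).

(** The centred case of [gaussian], bundled as a probability on [R] with its canonical measurable
    structure. Variance 0 is kept, as a point mass, for a noiseless observation. *)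
Definition gauss v : probability R R :=
  if v == 0 then (\d_(0 : R) : probability R R)
  else (distribution (normal_prob 0 (Num.sqrt v)) idR : probability R R).

Lemma gaussianE v (A : set R) : gaussian 0 v A = gauss v A.
Proof. by rewrite /gaussian /gauss; case: ifP. Qed.

Definition gauss_pdf v x := normal_pdf 0 (Num.sqrt v) x.

(* The logarithm of the ratio of the N(0, a) density at [x] and the N(0, b)
   density at [y]. *)
Definition llr a b x y := 2^-1 * (ln b - ln a + y ^+ 2 / b - x ^+ 2 / a).

Lemma gauss_pdfE v x : 0 < v ->
  gauss_pdf v x = expR (- 2^-1 * (ln (2 * pi) + ln v + x ^+ 2 / v)).
Proof.
move=> v0; have sv0 : Num.sqrt v != 0 by rewrite gt_eqF// sqrtr_gt0.
have p0 : 0 < 2 * pi :> R by rewrite mulr_gt0// pi_gt0.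
rewrite /gauss_pdf normal_pdfE// /normal_peak /normal_fun sqr_sqrtr ?ltW//.
rewrite subr0 -lnM ?posrE//.
rewrite [X in _ = expR X]mulrDr expRD; congr (_ * _).
  have q0 : 0 < 2 * pi * v by rewrite mulr_gt0.
  rewrite (_ : v * pi *+ 2 = 2 * pi * v); last by rewrite -mulr_natl; ring.
  by rewrite mulNr expRN -powR12_sqrt ?ltW// /powR gt_eqF.
by congr expR; field; rewrite gt_eqF.
Qed.

Lemma gauss_pdf_llr a b x y : 0 < a -> 0 < b ->
  gauss_pdf a x = expR (llr a b x y) * gauss_pdf b y.
Proof.
by move=> a0 b0; rewrite !gauss_pdfE// -expRD; congr expR; rewrite /llr; ring.
Qed.

Lemma gauss_pdf_ge0 v x : 0 <= gauss_pdf v x.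
Proof. exact: normal_pdf_ge0. Qed.

Lemma measurable_gauss_pdf v : measurable_fun setT (gauss_pdf v).
Proof. exact: measurable_normal_pdf. Qed.

Lemma gauss_density v F : 0 < v ->
  measurable_fun setT F -> (forall x, (0 <= F x)%E) ->
  (\int[gauss v]_x F x = \int[mu]_x (F x * (gauss_pdf v x)%:E))%E.
Proof.
move=> v0 mF F0; rewrite /gauss gt_eqF// ge0_integral_distribution//.
exact: ge0_integral_normal_prob.
Qed.

Lemma gauss0 F : measurable_fun setT F -> (\int[gauss 0]_x F x = F 0%R)%E.
Proof. by move=> mF; rewrite /gauss eqxx integral_dirac// diracT mul1e. Qed.

Lemma measurable_llr a b : measurable_fun setT (fun z => llr a b z.1 z.2).
Proof.
apply: measurable_funM => //.
apply: measurable_funB; first apply: measurable_funD => //.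
  by apply: measurable_funM => //; exact: measurable_funX.
by apply: measurable_funM => //; exact: measurable_funX.
Qed.

(** Elementary change of measure: the exponential of [llr] turns the N(0, b) density at t into the
    N(0, a) density at t + c, and Lebesgue measure is invariant under the translation. Under the
    tilted law, t + c is N(0, a). *)
Lemma gauss_shift a b c F : 0 < a -> 0 < b ->
  measurable_fun setT F -> (forall x, (0 <= F x)%E) ->
  (\int[gauss b]_t (F (t + c)%R * (expR (llr a b (t + c) t))%:E) =
   \int[gauss a]_t F t)%E.
Proof.
move=> a0 b0 mF F0.
have ms : measurable_fun setT (fun t : R => t + c) by exact: measurable_funD.
have mG : measurable_fun setT
    (fun t : R => F (t + c)%R * (expR (llr a b (t + c) t))%:E)%E.
  apply: emeasurable_funM; first exact: measurableT_comp mF ms.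
  apply/measurable_EFinP; apply: measurableT_comp => //.
  apply: (@measurableT_comp _ _ _ _ _ _ (fun z => llr a b z.1 z.2) _
            (fun t : R => (t + c, t))); first exact: measurable_llr.
  exact: measurable_fun_pair.
have G0 t : (0 <= F (t + c)%R * (expR (llr a b (t + c) t))%:E)%E.
  by rewrite mule_ge0// lee_fin expR_ge0.
have E := gauss_density b0 mG G0.
have E' := gauss_density a0 mF F0.
etransitivity; first exact: E.
rewrite E'.
rewrite -[RHS](ge0_integral_shift c); first last.
- by move=> x; rewrite mule_ge0// lee_fin gauss_pdf_ge0.
- apply: emeasurable_funM => //; apply/measurable_EFinP.
  exact: measurable_gauss_pdf.
have H (t : R) : (F (t + c)%R * (gauss_pdf a (t + c))%:E =
    F (t + c)%R * (expR (llr a b (t + c) t))%:E * (gauss_pdf b t)%:E)%E.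
  by rewrite (gauss_pdf_llr (t + c) t a0 b0) EFinM muleA.
by apply: eq_integral => t _; rewrite [RHS]H.
Qed.

Lemma gauss_sym v F : 0 <= v ->
  measurable_fun setT F -> (forall x, (0 <= F x)%E) ->
  (\int[gauss v]_t F (- t)%R = \int[gauss v]_t F t)%E.
Proof.
move=> v0 mF F0.
have mN : measurable_fun setT (fun t : R => - t) by exact: oppr_measurable.
move: v0; rewrite le_eqVlt => /predU1P[<-|v0].
  by rewrite !gauss0// ?oppr0//; exact: measurableT_comp mF mN.
rewrite (gauss_density v0 mF F0) (gauss_density v0 (measurableT_comp mF mN))//.
pose G x := (F x * (gauss_pdf v x)%:E)%E.
have mG : measurable_fun setT G.
  apply: emeasurable_funM => //; apply/measurable_EFinP.
  exact: measurable_gauss_pdf.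
transitivity (\int[mu]_x G (- (x : R))%R)%E.
  apply: eq_integral => x _; rewrite /G; congr (_ * _%:E)%E.
  by rewrite !gauss_pdfE// sqrrN.
have mf : measurable_fun [set: measurableTypeR R]
   (-%R : _ -> measurableTypeR R) by [].
rewrite -(@ge0_integral_pushforward _ _ _ _ _ _ mf mu setT G)//.
- by apply: eq_measure_integral => A mA _; exact: lebesgue_measureN.
- by move=> x _; rewrite mule_ge0// lee_fin gauss_pdf_ge0.
- by move=> x; exact: F0.
Qed.

End Gaussian.

Section GaussianMoments.
Context {R : realType}.

Lemma prob_integral_cst d (T : measurableType d) (P : probability T R) (c : \bar R) :
  (\int[P]_x c = c)%E.
Proof. by rewrite integral_cst//= probability_setT mule1. Qed.

Lemma ln_le_subr1 (s : R) : 0 < s -> ln s <= s - 1.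
Proof.
by move=> s0; have := @le_ln1Dx R (s - 1); rewrite [1 + _]addrC subrK; apply; lra.
Qed.

(** [gauss_shift] without translation and with F = 1, from variance v to variance s v: an
    exponential moment of the square without any integral to compute. *)
Lemma gauss_llr_sqr (v s : R) : 0 < v -> 0 < s ->
  (\int[gauss v]_t (expR (2^-1 * ((1 - s^-1) / v * t ^+ 2 - ln s)))%:E = 1)%E.
Proof.
move=> v0 s0; have vs0 : 0 < s * v by rewrite mulr_gt0.
have := @gauss_shift R (s * v) v 0 (cst 1%E) vs0 v0 (@measurable_cst _ _ _ _ _ _) (fun=> lee01).
rewrite [X in _ = X -> _]prob_integral_cst => <-.
apply: eq_integral => t _; rewrite mul1e addr0; congr (expR _)%:E.
by rewrite /llr lnM ?posrE//; field; rewrite !gt_eqF.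
Qed.

(** Differentiating [gauss_llr_sqr] at s = 1 would show that the moment m is v. In place of the
    derivative, 1 + u <= exp u and ln s <= s - 1 give m <= s v for s > 1 and m >= s v for s < 1. *)
Lemma gauss_moment2 (v : R) : 0 <= v -> (\int[gauss v]_t (t ^+ 2)%:E = v%:E)%E.
Proof.
have msq : measurable_fun setT (fun t : R => (t ^+ 2)%:E).
  by apply/measurable_EFinP; exact: measurable_funX.
rewrite le_eqVlt => /predU1P[<-|v0]; first by rewrite gauss0// expr0n.
have mexp s : measurable_fun setT
    (fun t : R => (expR (2^-1 * ((1 - s^-1) / v * t ^+ 2 - ln s)))%:E).
  apply/measurable_EFinP; apply: measurableT_comp => //.
  apply: measurable_funM => //; apply: measurable_funB => //.
  by apply: measurable_funM => //; exact: measurable_funX.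
have sq0 (t : R) : (0 <= (t ^+ 2)%:E)%E by rewrite lee_fin sqr_ge0.
have I0 : (0 <= \int[gauss v]_t (t ^+ 2)%:E)%E by exact: integral_ge0.
have ub s : 1 < s -> (((1 - s^-1) / v / 2)%:E * \int[gauss v]_t (t ^+ 2)%:E
    <= ((s - 1) / 2)%:E)%E.
  move=> s1; have s0 : 0 < s by rewrite (lt_trans _ s1).
  have k0 : 0 <= (1 - s^-1) / v / 2.
    by rewrite !divr_ge0// ?(ltW v0)// subr_ge0 invf_le1// ltW.
  rewrite -ge0_integralZl_EFin//.
  have : (\int[gauss v]_t (1%:E + ((1 - s^-1) / v / 2)%:E * (t ^+ 2)%:E) <=
     \int[gauss v]_t ((expR (2^-1 * ((1 - s^-1) / v * t ^+ 2 - ln s)))%:E +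
        ((s - 1) / 2)%:E))%E.
    apply: ge0_le_integral => //.
    - by move=> t _; rewrite adde_ge0// mule_ge0// lee_fin.
    - by apply: emeasurable_funD => //; exact: emeasurable_funM.
    - by apply: emeasurable_funD.
    - move=> t _; rewrite lee_fin.
      have := expR_ge1Dx (2^-1 * ((1 - s^-1) / v * t ^+ 2 - ln s)).
      have := ln_le_subr1 s0.
      by set w := (1 - _) / v; lra.
  rewrite ge0_integralD//; first last.
  - exact: emeasurable_funM.
  - by move=> t _; rewrite mule_ge0// lee_fin.
  rewrite ge0_integralD//; last first.
    by move=> t _; rewrite lee_fin divr_ge0// subr_ge0 ltW.
  rewrite gauss_llr_sqr// !prob_integral_cst.
  by rewrite leeD2lE.
have lb s : 0 < s -> s < 1 -> (((1 - s) / 2)%:E <=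
    ((s^-1 - 1) / v / 2)%:E * \int[gauss v]_t (t ^+ 2)%:E)%E.
  move=> s0 s1.
  have k0 : 0 <= (s^-1 - 1) / v / 2.
    by rewrite !divr_ge0// ?(ltW v0)// subr_ge0 invf_ge1// ltW.
  rewrite -ge0_integralZl_EFin//.
  have : (\int[gauss v]_t (1%:E + ((1 - s) / 2)%:E) <=
     \int[gauss v]_t ((expR (2^-1 * ((1 - s^-1) / v * t ^+ 2 - ln s)))%:E +
        ((s^-1 - 1) / v / 2)%:E * (t ^+ 2)%:E))%E.
    apply: ge0_le_integral => //.
    - by move=> t _; rewrite -EFinD lee_fin; lra.
    - by apply: emeasurable_funD => //; exact: emeasurable_funM.
    - move=> t _; rewrite lee_fin.
      have := expR_ge1Dx (2^-1 * ((1 - s^-1) / v * t ^+ 2 - ln s)).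
      have := ln_le_subr1 s0.
      rewrite -[s^-1 - 1]opprB; set w := (1 - s^-1) / v.
      by rewrite !mulNr -/w; lra.
  rewrite ge0_integralD//; last first.
    by move=> t _; rewrite lee_fin divr_ge0// subr_ge0 ltW.
  rewrite ge0_integralD//; first last.
  - exact: emeasurable_funM.
  - by move=> t _; rewrite mule_ge0// lee_fin.
  rewrite gauss_llr_sqr// !prob_integral_cst.
  by rewrite leeD2lE.

(* The upper bound at s = 2 gives finiteness, after which both families of bounds concern a real
   number. *)
have : (\int[gauss v]_t (t ^+ 2)%:E < +oo)%E.
  have := ub 2 ltac:(lra); set I := integral _ _ _.
  have k0 : 0 < (1 - 2^-1) / v / 2 :> R by rewrite !divr_gt0//; lra.
  case: I I0 => [i _ _| _ |]//; first exact: ltry.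
  by rewrite mulry gtr0_sg// mul1e.
move: ub lb; move: (integral _ _ _) I0 => [m _ ub lb _|//|//].
congr EFin; apply/eqP; rewrite eq_le; apply/andP; split.
  apply/ler_addgt0Pr => e e0.
  have s1 : 1 < 1 + e / v by rewrite ltrDl divr_gt0.
  have := ub _ s1; rewrite -EFinM lee_fin; set s := 1 + e / v.
  have -> : v + e = v * s by rewrite /s; field; rewrite gt_eqF.
  have s0 : 0 < s by rewrite (lt_trans _ s1).
  have -> : (1 - s^-1) / v / 2 * m = (s - 1) / 2 * (m / (v * s)).
    by field; rewrite !gt_eqF.
  rewrite ger_pMr ?divr_gt0 ?subr_gt0//.
  by rewrite ler_pdivrMr ?mulr_gt0// mul1r.
apply/ler_addgt0Pr => e e0.
(* For s = v / (v + e), s v = v - e s, which is at least v - e since s < 1. *)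
have ev : 0 < v / (v + e) by rewrite divr_gt0// addr_gt0.
have ev1 : v / (v + e) < 1 by rewrite ltr_pdivrMr ?addr_gt0// mul1r ltrDl.
have := lb _ ev ev1; rewrite -EFinM lee_fin; set s := v / (v + e).
have -> : (s^-1 - 1) / v / 2 * m = (1 - s) / 2 * (m / (v * s)).
  by field; rewrite !gt_eqF.
rewrite ler_pMr ?divr_gt0 ?subr_gt0//.
have vs0 : 0 < v * s by rewrite mulr_gt0.
rewrite (ler_pdivlMr _ _ vs0) mul1r.
move=> vs; have : v * s = v - e * s by rewrite /s; field; rewrite gt_eqF// addr_gt0.
by move=> E; rewrite E in vs; have : e * s <= e; [rewrite ger_pMr// ltW|lra].
Qed.

End GaussianMoments.

Section Shear.
Context {R : realType}.

Lemma tonelli d1 d2 (T1 : measurableType d1) (T2 : measurableType d2)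
    (P1 : probability T1 R) (P2 : probability T2 R) (f : T1 * T2 -> \bar R) :
  measurable_fun setT f -> (forall z, (0 <= f z)%E) ->
  (\int[P1]_x \int[P2]_y f (x, y) = \int[P2]_y \int[P1]_x f (x, y))%E.
Proof. exact: fubini_tonelli. Qed.

Lemma measurable_pair_r d1 d2 d3 (T1 : measurableType d1) (T2 : measurableType d2)
    (T3 : measurableType d3) (f : T1 * T2 -> T3) (x : T1) :
  measurable_fun setT f -> measurable_fun setT (fun y => f (x, y)).
Proof.
move=> mf; apply: (measurableT_comp mf (g := fun y : T2 => (x, y))).
exact: measurable_fun_pair.
Qed.

(** Orthogonal decomposition: s minus its best linear estimate from s + u is independent of s + u.
    One [gauss_shift] replaces u by the sum, the integrals are exchanged, and another one replaces s
    by the error. *)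
Lemma gauss_shear (a b : R) (F : R * R -> \bar R) : 0 < a -> 0 <= b ->
  measurable_fun setT F -> (forall z, (0 <= F z)%E) ->
  (\int[gauss a]_s \int[gauss b]_u F (s + u, s - a / (a + b) * (s + u))%R =
   \int[gauss (a + b)]_v \int[gauss (a * b / (a + b))]_w F (v, w))%E.
Proof.
move=> a0 b0 mF F0.
set l := a / (a + b).
have mS : measurable_fun setT (fun z : R * R => F (z.1 + z.2, z.1 - l * (z.1 + z.2))%R).
  apply: (measurableT_comp mF); apply: measurable_fun_pair.
    exact: measurable_funD.
  apply: measurable_funB => //; apply: measurable_funM => //.
  exact: measurable_funD.
(* For b = 0 there is no density for u: l = 1, the error vanishes, and both sides evaluate point
   masses. *)
move: b0; rewrite le_eqVlt => /predU1P[b0|b0].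
  have l1 : l = 1 by rewrite /l -b0 addr0 divff// gt_eqF.
  rewrite -b0 mulr0 mul0r addr0; apply: eq_integral => s _.
  rewrite gauss0; last exact: (measurable_pair_r s mS).
  rewrite gauss0; last exact: (measurable_pair_r s mF).
  by rewrite addr0 l1 mul1r subrr.
have V0 : 0 < a + b by rewrite addr_gt0.
have w0 : 0 < a * b / (a + b) by rewrite divr_gt0 ?mulr_gt0.
pose G (z : R * R) := (F (z.2, z.1 - l * z.2)%R *
  (expR (llr b (a + b) (z.2 - z.1) z.2))%:E)%E.
have mG : measurable_fun setT G.
  apply: emeasurable_funM.
    apply: (measurableT_comp mF); apply: measurable_fun_pair => //.
    by apply: measurable_funB => //; exact: measurable_funM.
  apply/measurable_EFinP; apply: measurableT_comp => //.
  apply: (measurableT_comp (measurable_llr _ _)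
            (g := fun z : R * R => (z.2 - z.1, z.2)%R)).
  by apply: measurable_fun_pair => //; exact: measurable_funB.
have G0 z : (0 <= G z)%E by rewrite mule_ge0// lee_fin expR_ge0.
transitivity (\int[gauss a]_s \int[gauss (a + b)]_t G (s, t))%E.
  apply: eq_integral => s _.
  transitivity (\int[gauss (a + b)]_t (F (s + (t - s), s - l * (s + (t - s)))%R *
      (expR (llr b (a + b) (t - s) t))%:E))%E.
    apply/esym.
    exact: (@gauss_shift R b (a + b) (- s) (fun u => F (s + u, s - l * (s + u)))%R
      b0 V0 (measurable_pair_r s mS) (fun u => F0 _)).
  apply: eq_integral => t _.
  by rewrite /G/= [s + _]addrC subrK.
transitivity (\int[gauss (a + b)]_t \int[gauss a]_s G (s, t))%E.
  exact: (tonelli _ _ mG G0).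
apply: eq_integral => t _.
transitivity (\int[gauss a]_s (F (t, s - l * t)%R *
    (expR (llr (a * b / (a + b)) a (s - l * t) s))%:E))%E; last first.
  exact: (@gauss_shift R _ a (- (l * t)) (fun w => F (t, w)) w0 a0
    (measurable_pair_r t mF) (fun w => F0 _)).
(* Bayes' rule in logarithmic form: p_a(s) p_b(t - s) = p_(a+b)(t) p_w(s - l t), where w = a b / (a
   + b). *)
apply: eq_integral => s _; rewrite /G/=; congr (_ * (expR _)%:E)%E.
by rewrite /llr lnM ?posrE ?mulr_gt0 ?invr_gt0// lnM ?posrE// lnV ?posrE// /l;
  field; rewrite !gt_eqF.
Qed.

End Shear.

(** * Product measures on tuples *)

Section Tuples.
Context {d d'} {T : measurableType d} {T' : measurableType d'}.

Definition cons_tuple n (z : T * n.-tuple T) : n.+1.-tuple T :=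
  [the n.+1.-tuple T of z.1 :: z.2].

Lemma measurable_cons_tuple n : measurable_fun setT (@cons_tuple n).
Proof. exact: measurable_cons. Qed.

HB.instance Definition _ n :=
  isMeasurableFun.Build _ _ _ _ (@cons_tuple n) (@measurable_cons_tuple n).

Lemma tnth_cons0 n (x : T) (t : n.-tuple T) : tnth (cons_tuple (x, t)) ord0 = x.
Proof. by []. Qed.

Lemma tnth_consS n (x : T) (t : n.-tuple T) (i : 'I_n) :
  tnth (cons_tuple (x, t)) (lift ord0 i) = tnth t i.
Proof. by rewrite /cons_tuple tnthS. Qed.

Lemma mktuple_cons n (f : 'I_n.+1 -> T) :
  [tuple f i | i < n.+1] = cons_tuple (f ord0, [tuple f (lift ord0 i) | i < n]).
Proof.
apply: eq_from_tnth => i; rewrite tnth_mktuple.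
by case: (unliftP ord0 i) => [j ->|->]; rewrite ?tnth_consS ?tnth_mktuple.
Qed.

Lemma measurable_mktuple n (f : 'I_n -> T' -> T) :
  (forall i, measurable_fun setT (f i)) ->
  measurable_fun setT (fun x => [tuple f i x | i < n]).
Proof.
move=> mf; apply/measurable_fun_tnthP => i.
by rewrite (_ : _ \o _ = f i)//; apply/funext => x /=; rewrite tnth_mktuple.
Qed.

End Tuples.

Section Power.
Context {d} {T : measurableType d} {R : realType}.

(** The n-fold product law, built by recursion so that integrals peel off one coordinate at a time,
    as in [integral_powmS]. *)
Fixpoint powm (P : probability T R) n : probability (n.-tuple T) R :=
  match n with
  | 0 => (\d_([tuple] : 0.-tuple T) : probability (0.-tuple T) R)
  | n.+1 => (distribution (P \x powm P n)%E (@cons_tuple _ T n) :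
              probability (n.+1.-tuple T) R)
  end.

Variable P : probability T R.

Lemma integral_powm0 (F : 0.-tuple T -> \bar R) : measurable_fun setT F ->
  (\int[powm P 0]_t F t = F [tuple])%E.
Proof. by move=> mF; rewrite integral_dirac// diracT mul1e. Qed.

Lemma integral_powmS n (F : n.+1.-tuple T -> \bar R) :
  measurable_fun setT F -> (forall t, (0 <= F t)%E) ->
  (\int[powm P n.+1]_t F t =
   \int[P]_x \int[powm P n]_t F (cons_tuple (x, t)))%E.
Proof.
move=> mF F0; rewrite /= (ge0_integral_distribution _ mF F0).
rewrite -[RHS](@fubini_tonelli1 _ _ _ _ _ P (powm P n) (F \o @cons_tuple _ T n))//.
- by apply: measurableT_comp mF _; exact: measurable_cons_tuple.
- by move=> z; exact: F0.
Qed.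

Lemma powm_box n (A : 'I_n -> set T) : (forall i, measurable (A i)) ->
  (powm P n [set t | forall i, A i (tnth t i)] = \prod_(i < n) P (A i))%E.
Proof.
elim: n A => [|n IHn] A mA /=.
  rewrite big_ord0 diracE mem_set//= => i; by case: i.
rewrite big_ord_recl -IHn => [|i]; last exact: mA.
rewrite /distribution /pushforward /=.
rewrite (_ : _ @^-1` _ = A ord0 `*` [set t | forall i, A (lift ord0 i) (tnth t i)]).
  rewrite product_measure1E//.
  rewrite (_ : [set t | _] = \bigcap_(i in [set: 'I_n]) ((@tnth _ T)^~ i @^-1` A (lift ord0 i))).
    apply: fin_bigcap_measurable => // i _.
    by rewrite -[X in measurable X]setTI; apply: measurable_tnth.
  by apply/seteqP; split=> [t /= H i _|t H i]; [exact: H|exact: (H i I)].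
apply/seteqP; split => -[x t] /=.
  move=> H; split; first exact: (H ord0).
  by move=> i; have := H (lift ord0 i); rewrite tnth_consS.
move=> [A0 At] i; case: (unliftP ord0 i) => [j ->|->//].
by rewrite tnth_consS.
Qed.

(** Boxes form a pi-system generating the sigma-algebra of tuples; the preimages under projections
    are the boxes with a single nontrivial side. *)
Lemma powm_unique n (Q : probability (n.-tuple T) R) :
  (forall A : 'I_n -> set T, (forall i, measurable (A i)) ->
    (Q [set t | forall i, A i (tnth t i)] = \prod_(i < n) P (A i))%E) ->
  forall B, measurable B -> Q B = powm P n B.
Proof.
move=> QA B mB.
pose G : set (set (n.-tuple T)) := [set X | exists A : 'I_n -> set T,
  (forall i, measurable (A i)) /\ X = [set t | forall i, A i (tnth t i)]].
apply: (measure_unique G (fun=> setT)) => //.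
- apply/seteqP; split.
    apply: smallest_sub; first exact: smallest_sigma_algebra.
    rewrite -bigcup_seq/=; apply: bigcup_sub => i _ _ [A mA <-].
    apply: sub_sigma_algebra.
    exists (fun j => if j == i then A else setT); split.
      by move=> j; case: ifP.
    apply/seteqP; split => t /=.
      by move=> [_ At] j; case: eqP => // ->.
    by move=> /(_ i); rewrite eqxx.
  apply: smallest_sub; first exact: sigma_algebra_measurable.
  move=> _ [A [mA ->]].
  rewrite (_ : [set t | _] = \bigcap_(i in [set: 'I_n]) ((@tnth _ T)^~ i @^-1` A i)).
    apply: fin_bigcap_measurable => // i _.
    by rewrite -[X in measurable X]setTI; apply: measurable_tnth.
  by apply/seteqP; split=> [t /= H i _|t H i]; [exact: H|exact: (H i I)].
- move=> _ _ [A [mA ->]] [A' [mA' ->]]; exists (fun i => A i `&` A' i); split.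
    by move=> i; exact: measurableI.
  apply/seteqP; split=> t /=; first by move=> [H H'] i.
  by move=> H; split=> i; have [] := H i.
- by move=> _; exists (fun=> setT); split => //; apply/seteqP; split.
- by rewrite bigcup_const.
- by move=> _ [A [mA ->]]; exact: etrans (QA A mA) (esym (powm_box mA)).
- by move=> _; rewrite [X in (X < _)%E]probability_setT ltry.
Qed.

End Power.

Section PowerIntegrals.
Context {R : realType}.

Lemma measurable_comp_cons d (T : measurableType d) n (F : n.+1.-tuple T -> \bar R) :
  measurable_fun setT F -> measurable_fun setT (fun z => F (cons_tuple z)).
Proof. by move=> mF; apply: measurableT_comp mF _; exact: measurable_cons_tuple. Qed.

Lemma measurable_integral_cons d (T : measurableType d) (P : probability T R) n
    (F : n.+1.-tuple T -> \bar R) :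
  measurable_fun setT F -> (forall t, (0 <= F t)%E) ->
  measurable_fun setT (fun x => (\int[powm P n]_t F (cons_tuple (x, t)))%E).
Proof.
move=> mF F0.
by apply: (@measurable_fun_fubini_tonelli_F _ _ _ _ _ (powm P n) (fun z => F (cons_tuple z)))
  => [|z]; [exact: measurable_comp_cons|exact: F0].
Qed.

(** The hypothesis is on integrals of nonnegative functions, the form in which [shear1_law] provides
    it. *)
Lemma powm_map d d' (T : measurableType d) (T' : measurableType d')
    (P : probability T R) (P' : probability T' R) (h : T -> T') :
  measurable_fun setT h ->
  (forall F : T' -> \bar R, measurable_fun setT F -> (forall x, (0 <= F x)%E) ->
    (\int[P]_x F (h x) = \int[P']_x F x)%E) ->
  forall n (F : n.-tuple T' -> \bar R),
    measurable_fun setT F -> (forall t, (0 <= F t)%E) ->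
  (\int[powm P n]_t F [tuple h (tnth t i) | i < n] = \int[powm P' n]_t F t)%E.
Proof.
move=> mh PP'; elim => [|n IHn] F mF F0.
  have m0 : measurable_fun setT (fun t : 0.-tuple T => F [tuple h (tnth t i) | i < 0]).
    by apply: (measurableT_comp mF); apply: measurable_mktuple => -[].
  rewrite (integral_powm0 _ m0) (integral_powm0 _ mF).
  by congr F; apply: eq_from_tnth => -[].
have mhn k : measurable_fun setT (fun t : k.-tuple T => [tuple h (tnth t i) | i < k]).
  apply: measurable_mktuple => i; apply: (measurableT_comp mh).
  exact: measurable_tnth.
rewrite (integral_powmS _ (measurableT_comp mF (mhn _)) (fun t => F0 _)).
rewrite (integral_powmS _ mF F0).
transitivity (\int[P]_x \int[powm P' n]_t F (cons_tuple (h x, t)))%E.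
  apply: eq_integral => x _.
  transitivity (\int[powm P n]_t
      F (cons_tuple (h x, [tuple h (tnth t i) | i < n])))%E.
    apply: eq_integral => t _ /=; rewrite mktuple_cons; congr (F (cons_tuple (_, _))).
    by apply: eq_from_tnth => i; rewrite !tnth_mktuple tnth_consS.
  apply: (IHn (fun t => F (cons_tuple (h x, t)))) => [|t]; last exact: F0.
  exact: measurable_pair_r (measurable_comp_cons mF).
apply: (PP' (fun y => \int[powm P' n]_t F (cons_tuple (y, t)))%E) => [|x].
  exact: measurable_integral_cons.
by apply: integral_ge0 => t _; exact: F0.
Qed.

(** [gauss_shift] coordinate by coordinate. The shift [c] will be what is fixed in the inner
    integral: the part of the output determined by the message and the observation, or the scaled
    estimate determined by the output. *)
Lemma powm_shift (a b : R) n (c : 'I_n -> R) (F : n.-tuple R -> \bar R) :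
  0 < a -> 0 < b -> measurable_fun setT F -> (forall t, (0 <= F t)%E) ->
  (\int[powm (gauss b) n]_t (F [tuple (tnth t i + c i)%R | i < n] *
     (expR (\sum_(i < n) llr a b (tnth t i + c i) (tnth t i)))%:E) =
   \int[powm (gauss a) n]_t F t)%E.
Proof.
move=> a0 b0; elim: n c F => [|n IHn] c F mF F0.
  set G := (fun t => _ * _)%E.
  have -> : G = F.
    apply/funext => t; rewrite /G big_ord0 expR0 mule1; congr F.
    by apply: eq_from_tnth => -[].
  by exact: etrans (integral_powm0 _ mF) (esym (integral_powm0 _ mF)).
have mtc k (e : 'I_k -> R) :
    measurable_fun setT (fun t : k.-tuple R => [tuple (tnth t i + e i)%R | i < k]).
  apply: measurable_mktuple => i; apply: measurable_funD => //.
  exact: measurable_tnth.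
have mE k (e : 'I_k -> R) : measurable_fun setT
    (fun t : k.-tuple R => (expR (\sum_(i < k) llr a b (tnth t i + e i) (tnth t i)))%:E).
  apply/measurable_EFinP; apply: measurableT_comp => //; apply: measurable_sum => i.
  apply: (measurableT_comp (measurable_llr a b)
    (g := fun t : k.-tuple R => (tnth t i + e i, tnth t i)%R)).
  have mt : measurable_fun setT (fun t : k.-tuple R => tnth t i).
    exact: measurable_tnth.
  by apply: measurable_fun_pair => //; exact: measurable_funD.
have e0 (x : R) : (0 <= (expR x)%:E)%E by rewrite lee_fin expR_ge0.
pose L (t : n.+1.-tuple R) := (F [tuple (tnth t i + c i)%R | i < n.+1] *
  (expR (\sum_(i < n.+1) llr a b (tnth t i + c i) (tnth t i)))%:E)%E.
have mL : measurable_fun setT L.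
  by apply: emeasurable_funM (mE _ c); exact: measurableT_comp mF (mtc _ c).
have L0 t : (0 <= L t)%E by exact: mule_ge0.
etransitivity; first exact: (integral_powmS (gauss b) mL L0).
etransitivity; last exact/esym/(integral_powmS (gauss a) mF F0).
pose G (y : R) := (\int[powm (gauss a) n]_t F (cons_tuple (y, t)))%E.
have mG : measurable_fun setT G by exact: measurable_integral_cons.
have G0 y : (0 <= G y)%E by apply: integral_ge0 => t _; exact: F0.
transitivity (\int[gauss b]_x (G (x + c ord0)%R *
    (expR (llr a b (x + c ord0) x))%:E))%E; last exact: (gauss_shift _ a0 b0 mG G0).
apply: eq_integral => x _.
pose c' i := c (lift ord0 i).
pose F' t := (F (cons_tuple ((x + c ord0)%R, t)) *
  (expR (llr a b (x + c ord0) x))%:E)%E.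
have mFx : measurable_fun setT (fun t => F (cons_tuple ((x + c ord0)%R, t))).
  exact: measurable_pair_r (measurable_comp_cons mF).
have mF' : measurable_fun setT F' by exact: emeasurable_funM.
have F'0 t : (0 <= F' t)%E by exact: mule_ge0.
transitivity (\int[powm (gauss a) n]_t F' t)%E; last first.
  by apply: ge0_integralZr => // t _; exact: F0.
etransitivity; last exact: (IHn c' F' mF' F'0).
apply: eq_integral => t _; rewrite /L /F' -muleA -EFinM -expRD.
rewrite mktuple_cons big_ord_recl tnth_cons0.
congr (F (cons_tuple (_, _)) * (expR (_ + _))%:E)%E.
  by apply: eq_from_tnth => i; rewrite !tnth_mktuple tnth_consS.
by apply: eq_bigr => i _; rewrite tnth_consS.
Qed.

(** Transposition between a block of pairs and a pair of blocks: the Gaussian decomposition acts on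
    letters, while encoder and decoder act on whole blocks. *)
Lemma powm_zip d1 d2 (T1 : measurableType d1) (T2 : measurableType d2)
    (P1 : probability T1 R) (P2 : probability T2 R) n
    (F : n.-tuple T1 * n.-tuple T2 -> \bar R) :
  measurable_fun setT F -> (forall z, (0 <= F z)%E) ->
  (\int[powm (P1 \x P2)%E n]_t
      F ([tuple (tnth t i).1 | i < n], [tuple (tnth t i).2 | i < n]) =
   \int[powm P1 n]_a \int[powm P2 n]_b F (a, b))%E.
Proof.
elim: n F => [|n IHn] F mF F0.
  have mz : measurable_fun setT (fun t : 0.-tuple (T1 * T2) =>
      ([tuple (tnth t i).1 | i < 0], [tuple (tnth t i).2 | i < 0])).
    by apply: measurable_fun_pair; apply: measurable_mktuple => -[].
  have m1 : measurable_fun setT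
      (fun a : 0.-tuple T1 => (\int[powm P2 0]_b F (a, b))%E).
    exact: (@measurable_fun_fubini_tonelli_F _ _ _ _ _ (powm P2 0) F).
  etransitivity; first exact: (integral_powm0 _ (measurableT_comp mF mz)).
  etransitivity; last exact/esym/(integral_powm0 P1 m1).
  etransitivity; last exact/esym/(integral_powm0 P2 (measurable_pair_r [tuple] mF)).
  by congr (F (_, _)); apply: eq_from_tnth => -[].
have mz : measurable_fun setT (fun t : n.+1.-tuple (T1 * T2) =>
    ([tuple (tnth t i).1 | i < n.+1], [tuple (tnth t i).2 | i < n.+1])).
  apply: measurable_fun_pair; apply: measurable_mktuple => i;
    apply: measurableT_comp => //; exact: measurable_tnth.
etransitivity.
  exact: (integral_powmS _ (measurableT_comp mF mz) (fun t => F0 _)).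
have mH4 d0 (T0 : measurableType d0) (f1 : T0 -> T1) f2 (f3 : T0 -> T2) f4 :
    measurable_fun setT f1 -> measurable_fun setT f2 ->
    measurable_fun setT f3 -> measurable_fun setT f4 ->
    measurable_fun setT (fun z => F (cons_tuple (f1 z, f2 z), cons_tuple (f3 z, f4 z))).
  move=> m1 m2 m3 m4; apply: (measurableT_comp mF).
  by apply: measurable_fun_pair; apply: (measurableT_comp (@measurable_cons_tuple _ _ _));
    exact: measurable_fun_pair.
transitivity (\int[(P1 \x P2)%E]_z \int[powm P1 n]_a \int[powm P2 n]_b
    F (cons_tuple (z.1, a), cons_tuple (z.2, b)))%E.
  apply: eq_integral => -[x y] _ /=.
  rewrite -(IHn (fun z => F (cons_tuple (x, z.1), cons_tuple (y, z.2)))) => [||z].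
  - apply: eq_integral => t _; congr (F (_, _)); rewrite mktuple_cons; congr cons_tuple;
    congr pair;
    by apply: eq_from_tnth => i; rewrite !tnth_mktuple tnth_consS.
  - exact: mH4.
  - exact: F0.
pose K (w : T1 * T2 * n.-tuple T1) := (\int[powm P2 n]_b
  F (cons_tuple (w.1.1, w.2), cons_tuple (w.1.2, b)))%E.
have mK : measurable_fun setT K.
  apply: (@measurable_fun_fubini_tonelli_F _ _ _ _ _ (powm P2 n)
    (fun z => F (cons_tuple (z.1.1.1, z.1.2), cons_tuple (z.1.1.2, z.2)))) => [|z].
  - by apply: mH4; do ?apply: measurableT_comp.
  - exact: F0.
have K0 w : (0 <= K w)%E by apply: integral_ge0 => b _; exact: F0.
transitivity (\int[P1]_x \int[P2]_y \int[powm P1 n]_a K (x, y, a))%E.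
  apply: (@fubini_tonelli1 _ _ _ _ _ P1 P2
    (fun z => \int[powm P1 n]_a K (z, a))%E) => [|z].
  - exact: (@measurable_fun_fubini_tonelli_F _ _ _ _ _ (powm P1 n) K).
  - by apply: integral_ge0 => a _; exact: K0.
have mR : measurable_fun setT (fun a => (\int[powm P2 n.+1]_b F (a, b))%E).
  exact: (@measurable_fun_fubini_tonelli_F _ _ _ _ _ (powm P2 n.+1) F).
etransitivity; last first.
  by apply/esym/(integral_powmS P1 mR) => a; exact: integral_ge0.
apply: eq_integral => x _.
transitivity (\int[powm P1 n]_a \int[P2]_y K (x, y, a))%E.
  apply: (@tonelli _ _ _ _ _ P2 (powm P1 n) (fun z => K (x, z.1, z.2))) => [|z].
    apply: (measurableT_comp mK); apply: measurable_fun_pair => //.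
    exact: measurable_fun_pair.
  exact: K0.
apply: eq_integral => a _; apply/esym.
exact: (integral_powmS P2 (measurable_pair_r (cons_tuple (x, a)) mF)).
Qed.

End PowerIntegrals.

(** * Laws of the blocks *)

Section Independence.
Context {d} {Omega : measurableType d} {R : realType} (Pr : probability Omega R).

Lemma ge0_integral_indep d1 d2 (T1 : measurableType d1) (T2 : measurableType d2)
    (P1 : probability T1 R) (P2 : probability T2 R) (X : Omega -> T1) (Y : Omega -> T2)
    (F : T1 * T2 -> \bar R) :
  measurable_fun setT X -> measurable_fun setT Y ->
  (forall A B, measurable A -> measurable B ->
    (Pr (X @^-1` A `&` Y @^-1` B) = P1 A * P2 B)%E) ->
  measurable_fun setT F -> (forall z, (0 <= F z)%E) ->
  (\int[Pr]_w F (X w, Y w) = \int[P1]_x \int[P2]_y F (x, y))%E.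
Proof.
move=> mX mY XY mF F0.
have mXY : measurable_fun setT (fun w => (X w, Y w)) by exact: measurable_fun_pair.
pose XY' : {mfun Omega >-> (T1 * T2)%type} :=
  HB.pack_for {mfun Omega >-> (T1 * T2)%type} (fun w => (X w, Y w))
    (isMeasurableFun.Build _ _ _ _ _ mXY).
transitivity (\int[distribution Pr XY']_z F z)%E.
  by rewrite (ge0_integral_distribution _ mF F0).
transitivity (\int[(P1 \x P2)%E]_z F z)%E; last exact: fubini_tonelli1.
apply: eq_measure_integral => A mA _; apply/esym.
by apply: product_measure_unique mA => B C mB mC; exact: XY.
Qed.

(* A pi-lambda argument: independence from an event extends from a generating
   pi-system to the generated sigma-algebra. *)
Lemma indep_event_pair d1 d2 (T1 : measurableType d1) (T2 : measurableType d2)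
    (C : set Omega) (X : Omega -> T1) (Y : Omega -> T2) :
  measurable C -> measurable_fun setT X -> measurable_fun setT Y ->
  (forall A B, measurable A -> measurable B ->
    (Pr (C `&` (X @^-1` A `&` Y @^-1` B)) =
     Pr C * Pr (X @^-1` A `&` Y @^-1` B))%E) ->
  forall D, measurable D ->
    (Pr (C `&` (fun w => (X w, Y w)) @^-1` D) =
     Pr C * Pr ((fun w => (X w, Y w)) @^-1` D))%E.
Proof.
move=> mC mX mY CXY.
have mXY : measurable_fun setT (fun w => (X w, Y w)) by exact: measurable_fun_pair.
have mp D : measurable D -> measurable ((fun w => (X w, Y w)) @^-1` D).
  by move=> mD; rewrite -[X in measurable X]setTI; exact: mXY.
have PC : Pr C \is a fin_num by exact: fin_num_measure.
move=> D; rewrite measurable_prod_measurableType => mD.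
apply: (@dynkin_induction _ (T1 * T2)%type
  [set A `*` B | A in measurable & B in measurable]
  (fun D => (Pr (C `&` (fun w => (X w, Y w)) @^-1` D) =
     Pr C * Pr ((fun w => (X w, Y w)) @^-1` D))%E)) => //.
- exact: measurable_prod_measurableType.
- move=> _ _ [A mA [B mB <-]] [A' mA' [B' mB' <-]].
  by rewrite -setXI; exists (A `&` A'); [exact: measurableI|];
    exists (B `&` B') => //; exact: measurableI.
- by rewrite preimage_setT setIT probability_setT mule1.
- by move=> _ [A mA [B mB <-]]; exact: CXY.
- move=> S mS; set E := _ @^-1` S => CE.
  have mE : measurable E by exact: mp.
  rewrite preimage_setC -/E -setDE.
  transitivity (Pr C - Pr (C `&` E))%E.
    by apply: measureD => //; rewrite ltey_eq PC.
  rewrite CE probability_setC// muleBr ?mule1//.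
- move=> G mG tG CG.
  rewrite preimage_bigcup setI_bigcupr !measure_bigcup//.
  + rewrite -[in RHS](fineK PC) -nneseriesZl//.
    by apply: eq_eseriesr => i _; rewrite fineK//; exact: CG.
  + by move=> i _; exact: mp.
  + apply/trivIsetP => i j _ _ ij; rewrite -preimage_setI.
    by move/trivIsetP: tG => ->//; rewrite preimage_set0.
  + by move=> i _; apply: measurableI => //; exact: mp.
  + apply/trivIsetP => i j _ _ ij; rewrite setIACA setIid -preimage_setI.
    by move/trivIsetP: tG => ->//; rewrite preimage_set0 setI0.
Qed.
End Independence.

Lemma measurable_block d (Omega : measurableType d) (R : realType) n
    (X : nat -> Omega -> R) :
  (forall i, measurable_fun setT (X i)) -> measurable_fun setT (block n X).
Proof. by move=> mX; apply: measurable_mktuple => i. Qed.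

Section Laws.
Context {d} {Omega : measurableType d} {R : realType} (Pr : probability Omega R).

Lemma law_block (v : R) (X : nat -> {RV Pr >-> R}) n : iid_gaussian v X ->
  forall B, measurable B -> (Pr (block n X @^-1` B) = powm (gauss v) n B)%E.
Proof.
move=> [dX iX] B mB.
have mX : measurable_fun setT (block n X) by exact: measurable_block.
pose X' : {mfun Omega >-> n.-tuple R} :=
  HB.pack_for {mfun Omega >-> n.-tuple R} (block n X : Omega -> n.-tuple R)
    (isMeasurableFun.Build _ _ _ _ _ mX).
apply: (@powm_unique _ _ _ _ _ (distribution Pr X' : probability _ R)) mB => A mA.
rewrite /= /distribution /pushforward /=.
(* Independence is stated for events indexed by all natural numbers; those beyond n are set to the
   sure event and do not enter the list. *)
pose A' (j : nat) : set Omega :=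
  if insub j is Some i then X j @^-1` (A i) else setT.
have := iX (iota 0 n) A' (iota_uniq _ _).
rewrite (_ : \bigcap_(_ in _) _ = block n X @^-1` [set t | forall i, A i (tnth t i)]).
  move=> ->.
    rewrite -[in LHS](subn0 n) -/(index_iota 0 n) big_mkord.
    apply: eq_bigr => i _; by rewrite /A' valK -gaussianE -(dX (val i)).
  move=> j; rewrite mem_iota/= add0n => jn; rewrite /A'; case: insubP => [i _ ij|].
    by rewrite -ij; exists (A i) => //; rewrite setTI.
  by rewrite jn.
apply/seteqP; split=> w /=.
  move=> H i; rewrite tnth_mktuple; have := H (val i).
  by rewrite /= mem_iota /= add0n ltn_ord /A' valK; apply.
move=> H j; rewrite /= mem_iota/= add0n => jn; rewrite /A'; case: insubP => [i _ ij|//].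
by have := H i; rewrite tnth_mktuple -ij.
Qed.

Lemma sigma_seq_block (X : nat -> {RV Pr >-> R}) n (B : set (n.-tuple R)) :
  measurable B -> sigma_seq X (block n X @^-1` B).
Proof.
move=> mB.
pose G := \bigcup_i sigma_rv (X i).
have mX : @measurable_fun _ _ (g_sigma_algebraType G) _ setT (block n X).
  apply: (@measurable_block _ (g_sigma_algebraType G) R n X) => i _ A mA.
  by apply: sub_sigma_algebra; exists i => //; exists A.
by have := mX measurableT B mB; rewrite setTI.
Qed.

Section Channel.
Variables (S U Z : nat -> {RV Pr >-> R}) (Q N su2 : R).
Hypothesis channel : gaussian_channel S U Z Q N su2.

Let mS n : measurable_fun setT (block n S). Proof. exact: measurable_block. Qed.
Let mU n : measurable_fun setT (block n U). Proof. exact: measurable_block. Qed.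
Let mZ n : measurable_fun setT (block n Z). Proof. exact: measurable_block. Qed.

Lemma indep_blocks n (A B C : set (n.-tuple R)) :
  measurable A -> measurable B -> measurable C ->
  (Pr (block n Z @^-1` A `&` (block n S @^-1` B `&` block n U @^-1` C)) =
   Pr (block n Z @^-1` A) * (Pr (block n S @^-1` B) * Pr (block n U @^-1` C)))%E.
Proof.
case: channel => _ _ _ ind mA mB mC.
have e10 : (inord 1 == ord0 :> 'I_3) = false by rewrite -val_eqE /= inordK.
have e20 : (inord 2 == ord0 :> 'I_3) = false by rewrite -val_eqE /= inordK.
have e21 : (inord 2 == inord 1 :> 'I_3) = false by rewrite -val_eqE /= !inordK.
(* The sigma-algebras come in the order S, Z, U in [gaussian_channel], whereas the conclusion
   isolates Z. *)
pose g (i : 'I_3) := if i == ord0 then block n S @^-1` B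
    else if i == inord 1 then block n Z @^-1` A else block n U @^-1` C.
have g0 : g ord0 = block n S @^-1` B by rewrite /g eqxx.
have g1 : g (inord 1) = block n Z @^-1` A by rewrite /g e10 eqxx.
have g2 : g (inord 2) = block n U @^-1` C by rewrite /g e20 e21.
have := ind [:: ord0; inord 1; inord 2] g.
rewrite !big_cons big_nil g0 g1 g2 mule1 => H; rewrite muleCA -H.
- congr (Pr _); apply/seteqP; split=> w /=.
    move=> [wA [wB wC]] i /=; rewrite !inE => /or3P[]/eqP->;
      by rewrite ?g0 ?g1 ?g2.
  move=> H'; have := H' ord0; have := H' (inord 1); have := H' (inord 2).
  rewrite /= !inE !eqxx !orbT g0 g1 g2 => h2 h1 h0.
  by split; [exact: h1|split; [exact: h0|exact: h2]].
- by rewrite /= !inE [ord0 == _]eq_sym e10 [ord0 == _]eq_sym e20 [inord 1 == _]eq_sym e21.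
- move=> i; rewrite !inE => /or3P[]/eqP->; rewrite ?g0 ?g1 ?g2.
  + by rewrite (tnth_nth set0)/=; exact: sigma_seq_block.
  + by rewrite (tnth_nth set0)/= inordK//=; exact: sigma_seq_block.
  + by rewrite (tnth_nth set0)/= inordK//=; exact: sigma_seq_block.
Qed.

Lemma law_blocks n (F : n.-tuple R * (n.-tuple R * n.-tuple R) -> \bar R) :
  measurable_fun setT F -> (forall z, (0 <= F z)%E) ->
  (\int[Pr]_w F (block n Z w, (block n S w, block n U w)) =
   \int[powm (gauss N) n]_z \int[powm (gauss Q) n]_s
     \int[powm (gauss su2) n]_u F (z, (s, u)))%E.
Proof.
case: (channel) => iS iZ iU _ mF F0.
have SU B : measurable B -> (Pr ((fun w => (block n S w, block n U w)) @^-1` B) =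
    (powm (gauss Q) n \x powm (gauss su2) n) B)%E.
  move=> mB.
  have mSU : measurable_fun setT (fun w => (block n S w, block n U w)).
    exact: (measurable_fun_pair (@mS n) (@mU n)).
  pose SU' : {mfun Omega >-> (n.-tuple R * n.-tuple R)%type} :=
    HB.pack_for {mfun Omega >-> (n.-tuple R * n.-tuple R)%type}
     (fun w => (block n S w, block n U w)) (isMeasurableFun.Build _ _ _ _ _ mSU).
  apply/esym; apply: (@product_measure_unique _ _ _ _ _ _ _ (distribution Pr SU')) mB.
  move=> A C mA mC; transitivity (Pr (block n S @^-1` A) * Pr (block n U @^-1` C))%E; last first.
    by congr (_ * _)%E; exact: law_block.
  have := indep_blocks measurableT mA mC.
  by rewrite !preimage_setT setTI probability_setT mul1e.
transitivity (\int[powm (gauss N) n]_z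
   \int[(powm (gauss Q) n \x powm (gauss su2) n)%E]_y F (z, y))%E.
  apply: (@ge0_integral_indep _ _ _ Pr _ _ _ _ (powm (gauss N) n)
     (powm (gauss Q) n \x powm (gauss su2) n)%E (block n Z)
     (fun w => (block n S w, block n U w))) => //.
    exact: (@mZ n).
    exact: (measurable_fun_pair (@mS n) (@mU n)).
  move=> A B mA mB; transitivity (Pr (block n Z @^-1` A) *
      Pr ((fun w => (block n S w, block n U w)) @^-1` B))%E; last first.
    by congr (_ * _)%E; [exact: law_block|exact: SU].
  apply: indep_event_pair mB => //.
  - by rewrite -[X in measurable X]setTI; exact: (@mZ n).
  - exact: (@mS n).
  - exact: (@mU n).
  move=> A' B' mA' mB'; rewrite indep_blocks//; congr (_ * _)%E.
  have := indep_blocks measurableT mA' mB'.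
  by rewrite !preimage_setT setTI probability_setT mul1e.
apply: eq_integral => z _.
exact: (@fubini_tonelli1 _ _ _ _ _ (powm (gauss Q) n) (powm (gauss su2) n)
  (fun y => F (z, y)) (measurable_pair_r z mF)).
Qed.

End Channel.
End Laws.

Section StateNoise.
Context {d} {Omega : measurableType d} {R : realType} (Pr : probability Omega R).
Variables (S U Z : nat -> {RV Pr >-> R}) (Q N su2 : R).
Hypothesis channel : gaussian_channel S U Z Q N su2.
Hypotheses (Q0 : 0 < Q) (N0 : 0 < N) (su20 : 0 <= su2).

Let lam := Q / (Q + su2).
Let N' := Q * su2 / (Q + su2).

(* For l = Q / (Q + su2), the part of S + Z uncorrelated with the observation
   S + U. *)
Definition residual (l : R) (i : nat) (w : Omega) : R :=
  S i w + Z i w - l * (S i w + U i w).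

(** Observation and residual as one linear map of (Z, (S, U)); [shear1] is its action on a single
    letter. *)
Let shear n (z : n.-tuple R * (n.-tuple R * n.-tuple R)) :=
  ([tuple (tnth z.2.1 i + tnth z.2.2 i)%R | i < n],
   [tuple (tnth z.2.1 i + tnth z.1 i - lam * (tnth z.2.1 i + tnth z.2.2 i))%R | i < n]).

Let shear1 (z : R * (R * R)) := (z.2.1 + z.2.2, z.2.1 + z.1 - lam * (z.2.1 + z.2.2)).

Let mshear n : measurable_fun setT (@shear n).
Proof.
have m1 (i : 'I_n) : measurable_fun setT
    (fun z : n.-tuple R * (n.-tuple R * n.-tuple R) => tnth z.1 i).
  exact: (measurableT_comp (measurable_tnth i) measurable_fst).
have m2 (i : 'I_n) : measurable_fun setT
    (fun z : n.-tuple R * (n.-tuple R * n.-tuple R) => tnth z.2.1 i).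
  apply: (measurableT_comp (measurable_tnth i)).
  exact: (measurableT_comp measurable_fst measurable_snd).
have m3 (i : 'I_n) : measurable_fun setT
    (fun z : n.-tuple R * (n.-tuple R * n.-tuple R) => tnth z.2.2 i).
  apply: (measurableT_comp (measurable_tnth i)).
  exact: (measurableT_comp measurable_snd measurable_snd).
apply: measurable_fun_pair; apply: measurable_mktuple => i.
  exact: measurable_funD.
apply: measurable_funB; first exact: measurable_funD.
by apply: measurable_funM => //; exact: measurable_funD.
Qed.

Let mshear1 : measurable_fun setT shear1.
Proof.
have m2 : measurable_fun setT (fun z : R * (R * R) => z.2.1).
  exact: (measurableT_comp measurable_fst measurable_snd).
have m3 : measurable_fun setT (fun z : R * (R * R) => z.2.2).
  exact: (measurableT_comp measurable_snd measurable_snd).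
apply: measurable_fun_pair; first exact: measurable_funD.
apply: measurable_funB; first exact: measurable_funD.
by apply: measurable_funM => //; exact: measurable_funD.
Qed.

(** [gauss_shear] twice: on (s, u), to obtain the observation and the estimation error of variance
    N', then on (z, error), of which only the sum is kept, the other coordinate integrating out. *)
Let shear1_law (F : R * R -> \bar R) :
  measurable_fun setT F -> (forall z, (0 <= F z)%E) ->
  (\int[(gauss N \x (gauss Q \x gauss su2))%E]_z F (shear1 z) =
   \int[(gauss (Q + su2) \x gauss (N + N'))%E]_z F z)%E.
Proof.
move=> mF F0.
have V0 : 0 < Q + su2 by rewrite ltr_wpDr.
have N'0 : 0 <= N' by rewrite /N' divr_ge0// ?mulr_ge0// ltW.
have mG := measurableT_comp mF mshear1.
have m4 d0 (T0 : measurableType d0) (f1 f2 : T0 -> R) :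
    measurable_fun setT f1 -> measurable_fun setT f2 ->
    measurable_fun setT (fun z => F (f1 z, f2 z)).
  by move=> mf1 mf2; apply: (measurableT_comp mF); exact: measurable_fun_pair.
transitivity (\int[gauss N]_z \int[gauss Q]_s \int[gauss su2]_u F (shear1 (z, (s, u))))%E.
  etransitivity.
    exact: (@fubini_tonelli1 _ _ _ _ _ (gauss N)
      ((gauss Q \x gauss su2)%E : probability (R * R)%type R) _ mG (fun=> F0 _)).
  apply: eq_integral => z _.
  exact: (@fubini_tonelli1 _ _ _ _ _ (gauss Q) (gauss su2) _
      (measurable_pair_r z mG) (fun=> F0 _)).
etransitivity; last first.
  exact/esym/(@fubini_tonelli1 _ _ _ _ _ (gauss (Q + su2)) (gauss (N + N')) _ mF F0).
transitivity (\int[gauss N]_z \int[gauss (Q + su2)]_v \int[gauss N']_w F (v, z + w)%R)%E.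
  apply: eq_integral => z _.
  have mFz : measurable_fun setT (fun y : R * R => F (y.1, z + y.2)%R).
    by apply: m4 => //; exact: measurable_funD.
  etransitivity; last exact: (gauss_shear Q0 su20 mFz (fun=> F0 _)).
  apply: eq_integral => s _; apply: eq_integral => u _.
  rewrite /shear1 -/lam; congr (F (_, _)) => /=.
  by rewrite addrA [z + s]addrC.
transitivity (\int[gauss (Q + su2)]_v \int[gauss N]_z \int[gauss N']_w F (v, z + w)%R)%E.
  apply: (@tonelli _ _ _ _ _ (gauss N) (gauss (Q + su2))
    (fun y => \int[gauss N']_w F (y.2, y.1 + w)%R)%E) => [|y].
    apply: (@measurable_fun_fubini_tonelli_F _ _ _ _ _ (gauss N')
      (fun y : R * R * R => F (y.1.2, y.1.1 + y.2)%R)) => //.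
    by apply: m4; [exact: measurableT_comp|apply: measurable_funD => //; exact: measurableT_comp].
  exact: integral_ge0.
apply: eq_integral => v _.
have := @gauss_shear R N N' (fun y => F (v, y.1)) N0 N'0 (m4 _ _ _ _ _ _) (fun=> F0 _).
move=> /(_ (measurable_cst _) measurable_fst)/= ->.
by apply: eq_integral => t _; exact: prob_integral_cst.
Qed.

Let noise_blocks n (w : Omega) : shear (block n Z w, (block n S w, block n U w)) =
  (obs_block S U n w, block n (residual lam) w).
Proof.
by rewrite /shear; congr pair; apply: eq_from_tnth => i; rewrite !tnth_mktuple.
Qed.

(** The blocks are transposed into letters by [powm_zip], [shear1_law] acts on each letter, and the
    result is transposed back. The product form says that observation and residual are
    independent. *)
Lemma law_obs_residual n (F : n.-tuple R * n.-tuple R -> \bar R) :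
  measurable_fun setT F -> (forall z, (0 <= F z)%E) ->
  (\int[Pr]_w F (obs_block S U n w, block n (residual lam) w) =
   \int[powm (gauss (Q + su2)) n]_v \int[powm (gauss (N + N')) n]_t F (v, t))%E.
Proof.
move=> mF F0.
have mFs := measurableT_comp mF (@mshear n).
etransitivity; last exact: (powm_zip _ _ mF F0).
transitivity (\int[Pr]_w (F \o @shear n) (block n Z w, (block n S w, block n U w)))%E.
  by apply: eq_integral => w _; rewrite [in RHS]/= noise_blocks.
etransitivity; first exact: (law_blocks channel mFs (fun=> F0 _)).
pose un2 d1 d2 (T1 : measurableType d1) (T2 : measurableType d2) (t : n.-tuple (T1 * T2)) :=
  ([tuple (tnth t i).1 | i < n], [tuple (tnth t i).2 | i < n]).
have mun d1 d2 (T1 : measurableType d1) (T2 : measurableType d2) :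
    measurable_fun setT (@un2 _ _ T1 T2).
  by apply: measurable_fun_pair; apply: measurable_mktuple => i;
    apply: measurableT_comp => //; exact: measurable_tnth.
pose F1 (y : n.-tuple R * n.-tuple (R * R)) := F (shear (y.1, un2 _ _ _ _ y.2)).
have mF1 : measurable_fun setT F1.
  apply: (measurableT_comp mFs); apply: measurable_fun_pair => //.
  exact: (measurableT_comp (@mun _ _ _ _) measurable_snd).
transitivity (\int[powm (gauss N) n]_z
    \int[powm (gauss Q \x gauss su2)%E n]_y F1 (z, y))%E.
  apply: eq_integral => z _; apply/esym.
  exact: (powm_zip _ _ (measurable_pair_r z mFs) (fun=> F0 _)).
etransitivity; first exact/esym/(powm_zip _ _ mF1 (fun=> F0 _)).
transitivity (\int[powm (gauss N \x (gauss Q \x gauss su2))%E n]_t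
   (F \o @un2 _ _ R R) [tuple shear1 (tnth t i) | i < n])%E.
  apply: eq_integral => t _; rewrite /F1/=; congr F; rewrite /shear/un2.
  by congr pair; apply: eq_from_tnth => i; rewrite !tnth_mktuple.
apply: (powm_map mshear1 shear1_law (measurableT_comp mF (mun _ _ _ _)) (fun=> F0 _)).
Qed.

End StateNoise.

Section Message.
Context {d} {Omega : measurableType d} {R : realType} (Pr : probability Omega R).
Variables (S U Z : nat -> {RV Pr >-> R}) (Q N su2 : R).
Hypothesis channel : gaussian_channel S U Z Q N su2.
Hypotheses (Q0 : 0 < Q) (N0 : 0 < N) (su20 : 0 <= su2).
Variables (n k : nat) (M : Omega -> 'I_k).
Hypothesis message : uniform_message S U Z n M.

Let lam := Q / (Q + su2).
Let N' := Q * su2 / (Q + su2).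

Lemma measurable_obs_residual l :
  measurable_fun setT (fun w => (obs_block S U n w, block n (residual S U Z l) w)).
Proof.
apply: measurable_fun_pair; apply: measurable_block => i.
  exact: measurable_funD.
apply: measurable_funB; first exact: measurable_funD.
by apply: measurable_funM => //; exact: measurable_funD.
Qed.

Lemma measurable_message_eq m : measurable_fun setT (fun w => M w == m).
Proof.
case: message => mM _ _ _ B _; rewrite setTI.
by rewrite (_ : _ @^-1` B = M @^-1` [set m' | B (m' == m)]).
Qed.

Lemma indep_message_obs_residual l (A : set (n.-tuple R * n.-tuple R)) (B : set bool) m :
  measurable A ->
  (Pr ((fun w => (obs_block S U n w, block n (residual S U Z l) w)) @^-1` A `&`
     (fun w => M w == m) @^-1` B) =
   Pr ((fun w => (obs_block S U n w, block n (residual S U Z l) w)) @^-1` A) *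
   Pr ((fun w => M w == m) @^-1` B))%E.
Proof.
case: message => _ _ ind mA.
set EA := _ @^-1` A; set EB := _ @^-1` B.
have e10 : (inord 1 == ord0 :> 'I_2) = false by rewrite -val_eqE /= inordK.
pose g (i : 'I_2) := if i == ord0 then EB else EA.
have g0 : g ord0 = EB by rewrite /g eqxx.
have g1 : g (inord 1) = EA by rewrite /g e10.
have := ind [:: ord0; inord 1] g.
rewrite !big_cons big_nil g0 g1 mule1 => H; rewrite muleC -H.
- congr (Pr _); apply/seteqP; split=> w /=.
    by move=> [wA wB] i /=; rewrite !inE => /orP[]/eqP->; rewrite ?g0 ?g1.
  move=> H'; have := H' ord0; have := H' (inord 1).
  by rewrite /= !inE !eqxx !orbT g0 g1 => h1 h0; split; [exact: h1|exact: h0].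
- by rewrite /= !inE [ord0 == _]eq_sym e10.
- move=> i; rewrite !inE => /orP[]/eqP->; rewrite ?g0 ?g1.
    rewrite (tnth_nth set0)/=; exists [set m' | B (m' == m)] => //.
    by rewrite setTI.
  rewrite (tnth_nth set0)/= inordK//=.
  (* [phi] presents both blocks as a measurable image of the state and the noises, so that the event
     lies in the sigma-algebra from which [uniform_message] declares the message independent. *)
  pose phi (z : n.-tuple R * n.-tuple R * n.-tuple R) :=
    ([tuple (tnth z.1.1 i + tnth z.1.2 i)%R | i < n],
     [tuple (tnth z.1.1 i + tnth z.2 i - l * (tnth z.1.1 i + tnth z.1.2 i))%R | i < n]).
  have mphi : measurable_fun setT phi.
    have m1 (j : 'I_n) : measurable_fun setT
        (fun z : n.-tuple R * n.-tuple R * n.-tuple R => tnth z.1.1 j).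
      apply: (measurableT_comp (measurable_tnth j)).
      exact: (measurableT_comp measurable_fst measurable_fst).
    have m2 (j : 'I_n) : measurable_fun setT
        (fun z : n.-tuple R * n.-tuple R * n.-tuple R => tnth z.1.2 j).
      apply: (measurableT_comp (measurable_tnth j)).
      exact: (measurableT_comp measurable_snd measurable_fst).
    have m3 (j : 'I_n) : measurable_fun setT
        (fun z : n.-tuple R * n.-tuple R * n.-tuple R => tnth z.2 j).
      exact: (measurableT_comp (measurable_tnth j) measurable_snd).
    apply: measurable_fun_pair; apply: measurable_mktuple => j.
      exact: measurable_funD.
    apply: measurable_funB; first exact: measurable_funD.
    by apply: measurable_funM => //; exact: measurable_funD.
  exists (phi @^-1` A).
    by rewrite -[X in measurable X]setTI; exact: mphi.
  rewrite setTI /EA; apply/seteqP; split=> w /=; congr A; congr pair;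
    by apply: eq_from_tnth => j; rewrite !tnth_mktuple.
Qed.

(** The integrand is split along the events M = m, each entering as a boolean variable independent
    of the two blocks and of probability 1 / k. *)
Lemma law_message_obs_residual (F : 'I_k -> n.-tuple R * n.-tuple R -> \bar R) :
  (forall m, measurable_fun setT (F m)) -> (forall m z, (0 <= F m z)%E) ->
  (\int[Pr]_w F (M w) (obs_block S U n w, block n (residual S U Z lam) w) =
   \sum_(m < k) (k%:R^-1)%:E * \int[powm (gauss (Q + su2)) n]_v
      \int[powm (gauss (N + N')) n]_t F m (v, t))%E.
Proof.
move=> mF F0.
set Y := fun w => (obs_block S U n w, block n (residual S U Z lam) w).
have mY : measurable_fun setT Y by exact: measurable_obs_residual.
pose Y' : {mfun Omega >-> (n.-tuple R * n.-tuple R)%type} :=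
  HB.pack_for {mfun Omega >-> (n.-tuple R * n.-tuple R)%type} Y
     (isMeasurableFun.Build _ _ _ _ _ mY).
pose X m : {mfun Omega >-> bool} :=
  HB.pack_for {mfun Omega >-> bool} (fun w => M w == m)
     (isMeasurableFun.Build _ _ _ _ _ (@measurable_message_eq m)).
pose G m (z : n.-tuple R * n.-tuple R * bool) := if z.2 then F m z.1 else 0%E.
have mG m : measurable_fun setT (G m).
  exact: (measurable_fun_if_pair (mF m) (measurable_cst 0%E)).
have G0 m z : (0 <= G m z)%E by rewrite /G; case: ifP.
have mXY : measurable_fun setT (fun w => \sum_(m < k) G m (Y w, X m w))%E.
  apply: emeasurable_sum => m; apply: (measurableT_comp (mG m)).
  by apply: measurable_fun_pair => //; exact: measurable_message_eq.
transitivity (\int[Pr]_w \sum_(m < k) G m (Y w, X m w))%E.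
  apply: eq_integral => w _; rewrite (bigD1 (M w))//= big1 ?adde0 /G/= ?eqxx//.
  by move=> m; rewrite eq_sym => /negbTE ->.
rewrite ge0_integral_sum//; last first.
  move=> m; apply: (measurableT_comp (mG m)).
  by apply: measurable_fun_pair => //; exact: measurable_message_eq.
apply: eq_bigr => m _.
etransitivity.
  apply: (@ge0_integral_indep _ _ _ Pr _ _ _ _ (distribution Pr Y') (distribution Pr (X m))
    Y (X m) (G m)) => //.
    by move=> A B mA mB; exact: indep_message_obs_residual.
transitivity (\int[distribution Pr Y']_y ((k%:R^-1)%:E * F m y))%E.
  apply: eq_integral => y _.
  transitivity (\int[Pr]_w (F m y * (\1_(M @^-1` [set m]) w)%:E))%E.
    etransitivity; first exact: (ge0_integral_distribution _ (measurable_pair_r y (mG m)) (fun=> G0 _ _)).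
    apply: eq_integral => w _; rewrite /G/= indicE.
    case: eqVneq => [H|/eqP H]; first by rewrite mem_set//= mule1.
    by rewrite memNset//= mule0.
  case: message => mM pM _.
  rewrite ge0_integralZl//; last first.
    by apply/measurable_EFinP; apply: measurable_indic; exact: mM.
  by rewrite integral_indic// setIT muleC; congr (_ * _)%E; exact: pM.
rewrite ge0_integralZl//; congr (_ * _)%E.
etransitivity; first exact: (ge0_integral_distribution _ (mF m) (F0 m)).
exact: (law_obs_residual channel).
Qed.

End Message.

(** * Exponential moments *)

Section Exponential.
Context {d} {Omega : measurableType d} {R : realType} (Pr : probability Omega R).
Variables (S U Z : nat -> {RV Pr >-> R}) (Q N su2 : R).
Hypothesis channel : gaussian_channel S U Z Q N su2.
Hypotheses (Q0 : 0 < Q) (N0 : 0 < N) (su20 : 0 <= su2).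
Variables (n k : nat) (M : Omega -> 'I_k) (c : @Defs.code R n k).
Hypothesis message : uniform_message S U Z n M.

Let lam := Q / (Q + su2).
Let N' := Q * su2 / (Q + su2).
Let V (i : nat) w := S i w + U i w.
Let T := residual S U Z lam.
Let Y := output S U Z c M.

(* The exponential of [hit] is the payoff k for a correctly decoded message and
   1 otherwise; it averages to at most 2 when the output is independent of the
   message. *)
Definition hit (m : 'I_k) (y : n.-tuple R) : R :=
  ln k%:R * \1_(dec_msg c @^-1` [set m]) y.

Lemma measurable_hit m : measurable_fun setT (hit m).
Proof.
by apply: measurable_funM => //; apply: measurable_indic; exact: dec_msg_measurable.
Qed.

(** Exactly one message is the decoded one: it contributes k and the k - 1 others contribute 1 each,
    so the average is (2 k - 1) / k. *)
Lemma sum_exp_hit y : \sum_(m < k) k%:R^-1 * expR (hit m y) <= 2.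
Proof.
have k0 : (0 < k)%N by case: (dec_msg c y) => m; apply: leq_ltn_trans.
rewrite -mulr_sumr ler_pdivrMl ?ltr0n//.
rewrite (bigD1 (dec_msg c y))//= /hit indicE mem_set// mulr1 lnK ?posrE ?ltr0n//.
rewrite (eq_bigr (fun=> 1)) => [|m mP]; last first.
  by rewrite indicE memNset ?mulr0 ?expR0//= => /eqP; rewrite eq_sym; exact/negP.
rewrite mulr2n mulrDr mulr1 lerD2l.
apply: (@le_trans _ _ (\sum_(m < k) 1)); last by rewrite sumr_const card_ord.
by rewrite [leRHS](bigD1 (dec_msg c y))//= lerDr.
Qed.

(** Independence of the output from the message is encoded by [mu] and [f] being the same for all
    [m]; this lets the sum over messages be taken pointwise. *)
Lemma integral_sum_exp_hit d' (T' : measurableType d') (mu : probability T' R)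
    (f : T' -> n.-tuple R) : measurable_fun setT f ->
  (\sum_(m < k) (k%:R^-1)%:E * \int[mu]_z (expR (hit m (f z)))%:E <= 2%:E)%E.
Proof.
move=> mf.
have mh m : measurable_fun setT (fun z => (expR (hit m (f z)))%:E).
  apply/measurable_EFinP; apply: measurableT_comp => //.
  exact: (measurableT_comp (measurable_hit m) mf).
have h0 m z : (0 <= (expR (hit m (f z)))%:E)%E by rewrite lee_fin expR_ge0.
rewrite (eq_bigr (fun m => \int[mu]_z ((k%:R^-1)%:E * (expR (hit m (f z)))%:E))%E).
  rewrite -ge0_integral_sum; [|by []| |]; first last.
  - by move=> m z _; rewrite mule_ge0// lee_fin.
  - by move=> m; exact: emeasurable_funM.
  rewrite -[leRHS](prob_integral_cst mu); apply: ge0_le_integral => //.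
  - by move=> z _; apply: sume_ge0 => m _; rewrite mule_ge0// lee_fin.
  - by apply: emeasurable_sum => m; exact: emeasurable_funM.
  - move=> z _; under eq_bigr do rewrite -EFinM.
    by rewrite sumEFin lee_fin sum_exp_hit.
by move=> m _; rewrite ge0_integralZl_EFin.
Qed.

(** The channel seen from (V, T): given the message and the observation, the output is the residual
    plus a constant vector, as [powm_shift] requires. *)
Let chan (m : 'I_k) (z : n.-tuple R * n.-tuple R) : n.-tuple R :=
  [tuple (tnth z.2 i + (tnth (enc c m z.1) i + lam * tnth z.1 i))%R | i < n].

Let outputE w : Y w = chan (M w) (obs_block S U n w, block n T w).
Proof.
apply: eq_from_tnth => i; rewrite !tnth_mktuple /T /residual /input /=.
by ring.
Qed.

Let mv (i : 'I_n) : measurable_fun setT (fun z : n.-tuple R * n.-tuple R => tnth z.1 i).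
Proof. exact: (measurableT_comp (measurable_tnth i) measurable_fst). Qed.

Let mt (i : 'I_n) : measurable_fun setT (fun z : n.-tuple R * n.-tuple R => tnth z.2 i).
Proof. exact: (measurableT_comp (measurable_tnth i) measurable_snd). Qed.

Let mx m (i : 'I_n) : measurable_fun setT
  (fun z : n.-tuple R * n.-tuple R => tnth (enc c m z.1) i).
Proof.
apply: (measurableT_comp (measurable_tnth i)).
exact: (measurableT_comp (enc_measurable c m) measurable_fst).
Qed.

Let mchan m : measurable_fun setT (chan m).
Proof.
apply: measurable_mktuple => i; apply: measurable_funD => //.
by apply: measurable_funD => //; exact: measurable_funM.
Qed.

Let mllr d' (T' : measurableType d') (a b : R) (f g : T' -> R) :
  measurable_fun setT f -> measurable_fun setT g ->
  measurable_fun setT (fun z => llr a b (f z) (g z)).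
Proof.
move=> mf mg; apply: (measurableT_comp (measurable_llr a b) (g := fun z => (f z, g z))).
exact: measurable_fun_pair.
Qed.

(** Under the reference law the output is a V plus an independent N(0, s2) noise, in which the
    message does not appear. For fixed m and v, [powm_shift] by x + (lam - a) v passes from the
    residual to that noise, which leads to [integral_sum_exp_hit]. *)
Lemma exp_rate_le2 (s2 a : R) : 0 < s2 ->
  (\int[Pr]_w (expR (hit (M w) (Y w) +
     \sum_(i < n) llr s2 (N + N') (tnth (Y w) i - a * V i w) (T i w)))%:E <= 2%:E)%E.
Proof.
move=> s20.
have nu0 : 0 < N + N' by rewrite ltr_wpDr// divr_ge0 ?mulr_ge0// ?ltW// ltr_wpDr.
pose F m z := (expR (hit m (chan m z) +
  \sum_(i < n) llr s2 (N + N') (tnth (chan m z) i - a * tnth z.1 i) (tnth z.2 i)))%:E.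
have mF m : measurable_fun setT (F m).
  apply/measurable_EFinP; apply: measurableT_comp => //; apply: measurable_funD.
    exact: (measurableT_comp (measurable_hit m) (mchan m)).
  apply: measurable_sum => i; apply: mllr => //; apply: measurable_funB.
    exact: (measurableT_comp (measurable_tnth i) (mchan m)).
  exact: measurable_funM.
have F0 m z : (0 <= F m z)%E by rewrite lee_fin expR_ge0.
rewrite (_ : (\int[Pr]_w _ =
    \int[Pr]_w F (M w) (obs_block S U n w, block n T w))%E); last first.
  apply: eq_integral => w _; rewrite /F -outputE; congr (expR (_ + _))%:E.
  by apply: eq_bigr => i _; rewrite !tnth_mktuple.
rewrite (law_message_obs_residual channel Q0 N0 su20 message mF F0).
(* The output under the reference law, as a function of V and of the new noise. *)
pose f (z : n.-tuple R * n.-tuple R) : n.-tuple R :=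
  [tuple (tnth z.2 i + a * tnth z.1 i)%R | i < n].
have mf : measurable_fun setT f.
  by apply: measurable_mktuple => i; apply: measurable_funD => //; exact: measurable_funM.
apply: le_trans (integral_sum_exp_hit
  ((powm (gauss (Q + su2)) n \x powm (gauss s2) n)%E : probability _ R) mf).
apply: lee_sum => m _; apply: lee_wpmul2l; first by [].
rewrite le_eqVlt; apply/orP; left; apply/eqP.
have mh : measurable_fun setT (fun z => (expR (hit m (f z)))%:E).
  apply/measurable_EFinP; apply: measurableT_comp => //.
  exact: (measurableT_comp (measurable_hit m) mf).
have h0 z : (0 <= (expR (hit m (f z)))%:E)%E by rewrite lee_fin expR_ge0.
etransitivity; last first.
  exact/esym/(@fubini_tonelli1 _ _ _ _ _ (powm (gauss (Q + su2)) n)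
    (powm (gauss s2) n) _ mh h0).
apply: eq_integral => v _.
etransitivity; last first.
  exact: (@powm_shift R s2 (N + N') n
    (fun i => tnth (enc c m v) i + (lam - a) * tnth v i) (fun t => (expR (hit m (f (v, t))))%:E)
    s20 nu0 (measurable_pair_r v mh) (fun=> h0 _)).
apply: eq_integral => t _; rewrite /F -[RHS]EFinM -[in RHS]expRD.
congr EFin; congr expR; congr (_ + _).
  congr hit; apply: eq_from_tnth => i; rewrite !tnth_mktuple; ring.
apply: eq_bigr => i _; rewrite tnth_mktuple; congr llr; ring.
Qed.

(** Here the reference law of each output letter is N(0, tau), without V. After exchanging the
    integrals over V and Y, the estimate is constant for fixed y, and the ratio in V is another
    instance of [powm_shift], which integrates to 1. *)
Lemma exp_distortion_le2 (dv tau b : R) : 0 < dv -> 0 < tau ->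
  (\int[Pr]_w (expR (hit (M w) (Y w) +
     \sum_(i < n) llr dv (Q + su2) (V i w - b * tnth (dec_state c (Y w)) i) (V i w) +
     \sum_(i < n) llr tau (N + N') (tnth (Y w) i) (T i w)))%:E <= 2%:E)%E.
Proof.
move=> dv0 tau0.
have V0 : 0 < Q + su2 by rewrite ltr_wpDr.
have nu0 : 0 < N + N' by rewrite ltr_wpDr// divr_ge0 ?mulr_ge0// ?ltW.
pose A m (z : n.-tuple R * n.-tuple R) := hit m z.2 +
  \sum_(i < n) llr dv (Q + su2) (tnth z.1 i - b * tnth (dec_state c z.2) i) (tnth z.1 i).
have mA m : measurable_fun setT (A m).
  apply: measurable_funD; first exact: (measurableT_comp (measurable_hit m) measurable_snd).
  apply: measurable_sum => i; apply: mllr => //; apply: measurable_funB => //.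
  apply: measurable_funM => //; apply: (measurableT_comp (measurable_tnth i)).
  exact: (measurableT_comp (dec_state_measurable c) measurable_snd).
pose F m z := (expR (A m (z.1, chan m z) +
  \sum_(i < n) llr tau (N + N') (tnth (chan m z) i) (tnth z.2 i)))%:E.
have mF m : measurable_fun setT (F m).
  apply/measurable_EFinP; apply: measurableT_comp => //; apply: measurable_funD.
    apply: (measurableT_comp (mA m) (g := fun z => (z.1, chan m z))).
    exact: measurable_fun_pair.
  apply: measurable_sum => i; apply: mllr => //.
  exact: (measurableT_comp (measurable_tnth i) (mchan m)).
have F0 m z : (0 <= F m z)%E by rewrite lee_fin expR_ge0.
rewrite (_ : (\int[Pr]_w _ =
    \int[Pr]_w F (M w) (obs_block S U n w, block n T w))%E); last first.
  apply: eq_integral => w _; rewrite /F /A -outputE; congr EFin; congr expR.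
  congr (_ + _).
    by congr (_ + _); apply: eq_bigr => i _; rewrite tnth_mktuple.
  by apply: eq_bigr => i _; congr llr; rewrite tnth_mktuple.
rewrite (law_message_obs_residual channel Q0 N0 su20 message mF F0).
apply: le_trans (integral_sum_exp_hit (powm (gauss tau) n) (@measurable_id _ _ setT)).
apply: lee_sum => m _; apply: lee_wpmul2l; first by [].
rewrite le_eqVlt; apply/orP; left; apply/eqP.
have mE : measurable_fun setT (fun z => (expR (A m z))%:E).
  by apply/measurable_EFinP; exact: measurableT_comp.
have E0 z : (0 <= (expR (A m z))%:E)%E by rewrite lee_fin expR_ge0.
transitivity (\int[powm (gauss (Q + su2)) n]_v
    \int[powm (gauss tau) n]_y (expR (A m (v, y)))%:E)%E.
  apply: eq_integral => v _.
  etransitivity; last first.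
    exact: (@powm_shift R tau (N + N') n (fun i => tnth (enc c m v) i + lam * tnth v i)
      (fun y => (expR (A m (v, y)))%:E) tau0 nu0 (measurable_pair_r v mE) (fun=> E0 _)).
  apply: eq_integral => t _; rewrite /F -[RHS]EFinM -[in RHS]expRD.
  congr EFin; congr expR; congr (_ + _).
  by apply: eq_bigr => i _; rewrite tnth_mktuple.
etransitivity; first exact: (tonelli _ _ mE E0).
apply: eq_integral => y _.
have mc : measurable_fun [set: n.-tuple R] (cst (expR (hit m y))%:E).
  exact: measurable_cst.
transitivity (\int[powm (gauss dv) n]_v (cst (expR (hit m y))%:E v))%E; last first.
  exact: prob_integral_cst.
etransitivity; last first.
  apply: (@powm_shift R dv (Q + su2) n (fun i => - (b * tnth (dec_state c y) i))
     (cst (expR (hit m y))%:E) dv0 V0 mc) => t.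
  by rewrite lee_fin expR_ge0.
by apply: eq_integral => v _; rewrite -[RHS]EFinM -[in RHS]expRD.
Qed.

End Exponential.

(** * Second moments *)

Section SquareIntegrable.
Context {d} {Omega : measurableType d} {R : realType} (Pr : probability Omega R).
Implicit Types f g : Omega -> R.

Local Notation I1 f := (Pr.-integrable setT (EFin \o f)).
Local Notation Ex f := (Rintegral Pr setT f).

Lemma expect_cst (c : R) : Ex (fun=> c) = c.
Proof. by rewrite /Rintegral (prob_integral_cst Pr c%:E). Qed.

Definition L2 f := measurable_fun setT f /\ (\int[Pr]_w (f w ^+ 2)%:E < +oo)%E.

Lemma L2_sqr f : L2 f -> I1 (fun w => f w ^+ 2).
Proof.
move=> [mf fin]; apply/integrableP; split.
  by apply/measurable_EFinP; exact: measurable_funX.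
by under eq_integral => w _ do rewrite /= ger0_norm ?sqr_ge0//.
Qed.

Lemma L2_integral f : L2 f -> (\int[Pr]_w (f w ^+ 2)%:E = (Ex (fun w => f w ^+ 2))%:E)%E.
Proof.
move=> /L2_sqr h; rewrite /Rintegral fineK//.
exact: (integrable_fin_num measurableT h).
Qed.

Lemma L2_mul f g : L2 f -> L2 g -> I1 (fun w => f w * g w).
Proof.
move=> Lf Lg.
have := integrableD measurableT (L2_sqr Lf) (L2_sqr Lg).
apply: le_integrable => //.
  by apply/measurable_EFinP; apply: measurable_funM; [case: Lf|case: Lg].
move=> w _; rewrite /= lee_fin normrM [leRHS]ger0_norm ?addr_ge0 ?sqr_ge0//.
rewrite -(real_normK (num_real (f w))) -(real_normK (num_real (g w))).
move: `|f w| `|g w| (normr_ge0 (f w)) (normr_ge0 (g w)) => x y x0 y0.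
by have := sqr_ge0 (x - y); have := mulr_ge0 x0 y0; rewrite !expr2; nra.
Qed.

Lemma L2_of_le f h : measurable_fun setT f -> I1 h ->
  (forall w, f w ^+ 2 <= h w) -> L2 f.
Proof.
move=> mf ih fh; split => //.
have mh := measurable_int _ ih.
apply: (@le_lt_trans _ _ (\int[Pr]_w (h w)%:E)%E).
  apply: ge0_le_integral => //.
  - by move=> w _; rewrite lee_fin sqr_ge0.
  - by apply/measurable_EFinP; exact: measurable_funX.
  - by move=> w _; rewrite lee_fin.
exact: (integrable_lty measurableT ih).
Qed.

Lemma L2D f g : L2 f -> L2 g -> L2 (fun w => f w + g w).
Proof.
move=> Lf Lg; have [mf _] := Lf; have [mg _] := Lg.
apply: (@L2_of_le _ (fun w => 2 * f w ^+ 2 + 2 * g w ^+ 2)).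
- exact: measurable_funD.
- apply: (integrableD measurableT (f := EFin \o (fun w => 2 * f w ^+ 2))
    (g := EFin \o (fun w => 2 * g w ^+ 2))).
    exact: (integrableZl measurableT 2 (L2_sqr Lf)).
  exact: (integrableZl measurableT 2 (L2_sqr Lg)).
- by move=> w; have := sqr_ge0 (f w - g w); rewrite !expr2; nra.
Qed.

Lemma L2Z (c : R) f : L2 f -> L2 (fun w => c * f w).
Proof.
move=> Lf; have [mf _] := Lf.
apply: (@L2_of_le _ (fun w => c ^+ 2 * f w ^+ 2)).
- exact: measurable_funM.
- exact: (integrableZl measurableT (c ^+ 2) (L2_sqr Lf)).
- by move=> w; rewrite exprMn.
Qed.

Lemma L2B f g : L2 f -> L2 g -> L2 (fun w => f w - g w).
Proof.
move=> Lf Lg; have := L2D Lf (L2Z (-1) Lg).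
by under [X in L2 X -> _]eq_fun do rewrite mulN1r.
Qed.

Lemma expect_sqrD (c : R) f g : L2 f -> L2 g ->
  Ex (fun w => (f w + c * g w) ^+ 2) =
  Ex (fun w => f w ^+ 2) + 2 * c * Ex (fun w => f w * g w) +
  c ^+ 2 * Ex (fun w => g w ^+ 2).
Proof.
move=> Lf Lg.
have i1 := L2_sqr Lf.
have i2 : I1 (fun w => 2 * c * (f w * g w)).
  exact: (integrableZl measurableT (2 * c) (L2_mul Lf Lg)).
have i3 : I1 (fun w => c ^+ 2 * g w ^+ 2).
  exact: (integrableZl measurableT (c ^+ 2) (L2_sqr Lg)).
rewrite -(RintegralZl _ measurableT (L2_mul Lf Lg)) -(RintegralZl _ measurableT (L2_sqr Lg)).
rewrite -(RintegralD measurableT i1 i2).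
rewrite -(RintegralD measurableT _ i3); last exact: (integrableD measurableT i1 i2).
by apply: eq_Rintegral => w _; ring.
Qed.

(** Jensen's inequality through one tangent line of the exponential, at ln 2: pointwise, f <= exp f
    / 2 + ln 2 - 1. *)
Lemma expect_exp_le2 f : I1 f -> (\int[Pr]_w (expR (f w))%:E <= 2%:E)%E ->
  Ex f <= ln 2.
Proof.
move=> i1 e2.
have mf := measurable_int _ i1.
have me : measurable_fun setT (fun w => (expR (f w))%:E).
  apply/measurable_EFinP; apply: measurableT_comp => //.
  exact/measurable_EFinP.
have ie : I1 (fun w => expR (f w)).
  apply/integrableP; split => //.
  under eq_integral => w _ do rewrite /= ger0_norm ?expR_ge0//.
  by apply: le_lt_trans e2 _; rewrite ltry.
have ie2 : I1 (fun w => 2^-1 * expR (f w)) by exact: (integrableZl measurableT 2^-1 ie).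
have ic : I1 (fun=> ln 2 - 1 : R) by exact: finite_measure_integrable_cst.
have E2 : Ex (fun w => expR (f w)) <= 2.
  rewrite -lee_fin /Rintegral fineK//; exact: (integrable_fin_num measurableT ie).
apply: (@le_trans _ _ (Ex (fun w => 2^-1 * expR (f w) + (ln 2 - 1)))).
  apply: (le_Rintegral measurableT i1 (integrableD measurableT ie2 ic)) => w _.
  have := expR_ge1Dx (f w - ln 2).
  by rewrite expRD expRN lnK ?posrE//; lra.
rewrite (RintegralD measurableT ie2 ic) (RintegralZl _ measurableT ie).
rewrite expect_cst.
by move: E2; set e := Rintegral _ _ _; lra.
Qed.

End SquareIntegrable.

Section Moments.
Context {R : realType}.

Lemma powm_marginal d (T : measurableType d) (P : probability T R) n (i : 'I_n)
    (F : T -> \bar R) : measurable_fun setT F -> (forall x, (0 <= F x)%E) ->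
  (\int[powm P n]_t F (tnth t i) = \int[P]_x F x)%E.
Proof.
move=> mF F0; elim: n i => [[]//|n IHn] i.
etransitivity.
  apply: (@integral_powmS _ _ _ P n (fun t => F (tnth t i))) => //.
  exact: measurableT_comp mF (measurable_tnth i).
case: (unliftP ord0 i) => [j ->|->].
  transitivity (\int[P]_x \int[powm P n]_t F (tnth t j))%E.
    by apply: eq_integral => x _; apply: eq_integral => t _; rewrite tnth_consS.
  by rewrite prob_integral_cst.
by apply: eq_integral => x _; exact: (prob_integral_cst (powm P n) (F x)).
Qed.

(** By symmetry of the law, the integral is also that of (h - t)^2; the sum of the two squares is 2
    h^2 + 2 t^2, so the cross term cancels without a first moment. *)
Lemma gauss_sqr_add (v h : R) : 0 <= v ->
  (\int[gauss v]_t ((h + t) ^+ 2)%:E = (h ^+ 2 + v)%:E)%E.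
Proof.
move=> v0.
have msq (e : R) : measurable_fun setT (fun t : R => ((h + e * t) ^+ 2)%:E).
  by apply/measurable_EFinP; apply: measurable_funX; apply: measurable_funD => //.
have sq0 (e t : R) : (0 <= ((h + e * t) ^+ 2)%:E)%E by rewrite lee_fin sqr_ge0.
set I := integral _ _ _.
have I1 : I = (\int[gauss v]_t ((h + 1 * t) ^+ 2)%:E)%E.
  by apply: eq_integral => t _; rewrite mul1r.
have I2 : I = (\int[gauss v]_t ((h + -1 * t) ^+ 2)%:E)%E.
  rewrite I1 -(gauss_sym v0 (msq 1) (sq0 1)).
  by apply: eq_integral => t _; rewrite mul1r mulN1r.
have : (I + I = (2 * h ^+ 2 + 2 * v)%:E)%E.
  rewrite {1}I1 I2 -ge0_integralD//.
  transitivity (\int[gauss v]_t ((2 * h ^+ 2)%:E + 2%:E * (t ^+ 2)%:E))%E.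
    by apply: eq_integral => t _; rewrite -EFinD -EFinM -EFinD; congr EFin; ring.
  rewrite ge0_integralD//; first last.
  - apply: emeasurable_funM => //; apply/measurable_EFinP; exact: measurable_funX.
  - by move=> t _; rewrite -EFinM lee_fin mulr_ge0// sqr_ge0.
  - by move=> t _; rewrite lee_fin mulr_ge0// sqr_ge0.
  rewrite prob_integral_cst ge0_integralZl_EFin//; first last.
  - apply/measurable_EFinP; exact: measurable_funX.
  - by move=> t _; rewrite lee_fin sqr_ge0.
  by rewrite gauss_moment2// -EFinM -EFinD.
move: I {I1 I2} => [r|//|//]; rewrite -EFinD => -[E]; congr EFin; lra.
Qed.

Context {d} {Omega : measurableType d} (Pr : probability Omega R).

Lemma iid_gaussian_moment2 (v : R) (X : nat -> {RV Pr >-> R}) i : 0 <= v ->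
  iid_gaussian v X -> (\int[Pr]_w (X i w ^+ 2)%:E = v%:E)%E.
Proof.
move=> v0 [dX _]; rewrite -(gauss_moment2 v0).
have msq : measurable_fun setT (fun t : R => (t ^+ 2)%:E).
  by apply/measurable_EFinP; exact: measurable_funX.
transitivity (\int[distribution Pr (X i)]_x (x ^+ 2)%:E)%E.
  rewrite (ge0_integral_distribution _ msq)// => x.
  by rewrite lee_fin sqr_ge0.
apply: eq_measure_integral => A mA _; exact: etrans (dX i A mA) (gaussianE v A).
Qed.

Variables (S U Z : nat -> {RV Pr >-> R}) (Q N su2 : R).
Hypothesis channel : gaussian_channel S U Z Q N su2.
Hypotheses (Q0 : 0 < Q) (N0 : 0 < N) (su20 : 0 <= su2).
Let lam := Q / (Q + su2).
Let N' := Q * su2 / (Q + su2).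

(** Read off the joint law of blocks of length i + 1 at the last coordinate, instead of expanding
    the square into a cross moment of S and U. *)
Lemma obs_moment2 (i : nat) :
  (\int[Pr]_w ((S i w + U i w) ^+ 2)%:E = (Q + su2)%:E)%E.
Proof.
have V0 : 0 < Q + su2 by rewrite ltr_wpDr.
have msq m (j : 'I_m) : measurable_fun setT (fun z : m.-tuple R => (tnth z j ^+ 2)%:E).
  by apply/measurable_EFinP; apply: measurable_funX; exact: measurable_tnth.
pose F (z : i.+1.-tuple R * i.+1.-tuple R) := (tnth z.1 ord_max ^+ 2)%:E.
have mF : measurable_fun setT F by exact: (measurableT_comp (msq _ _) measurable_fst).
have F0 z : (0 <= F z)%E by rewrite lee_fin sqr_ge0.
transitivity (\int[Pr]_w F (obs_block S U i.+1 w, block i.+1 (residual S U Z lam) w))%E.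
  by apply: eq_integral => w _; rewrite /F/= tnth_mktuple.
rewrite (law_obs_residual channel Q0 N0 su20 mF F0) -(gauss_moment2 (ltW V0)).
etransitivity; last first.
  apply: (@powm_marginal _ _ (gauss (Q + su2)) i.+1 ord_max (fun x => (x ^+ 2)%:E)).
    by apply/measurable_EFinP; exact: measurable_funX.
  by move=> x; rewrite lee_fin sqr_ge0.
apply: eq_integral => v _.
exact: (prob_integral_cst (powm (gauss (N + N')) i.+1) (tnth v ord_max ^+ 2)%:E).
Qed.

Variables (n k : nat) (M : Omega -> 'I_k).
Hypothesis message : uniform_message S U Z n M.

Lemma measurable_message d' (T' : measurableType d') (h : 'I_k -> T' -> R) (f : Omega -> T') :
  (forall m, measurable_fun setT (h m)) -> measurable_fun setT f ->
  measurable_fun setT (fun w => h (M w) (f w)).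
Proof.
move=> mh mf _ B mB; rewrite setTI.
rewrite (_ : _ @^-1` B = \bigcup_(m in [set: 'I_k])
    (M @^-1` [set m] `&` (h m \o f) @^-1` B)).
  apply: fin_bigcup_measurable => // m _; apply: measurableI.
    by case: message => mM _ _; exact: mM.
  rewrite -[X in measurable X]setTI.
  by apply: (measurableT_comp (mh m) mf).
apply/seteqP; split=> w /=; first by move=> H; exists (M w).
by move=> [m _ [-> ]].
Qed.

(** The residual is centred and independent of the message and the observation, so [gauss_sqr_add]
    applies once these are fixed. The integrals may be infinite: [h] is only measurable. *)
Lemma integral_residual_add (h : 'I_k -> n.-tuple R -> R) (i : 'I_n) :
  (forall m, measurable_fun setT (h m)) ->
  (\int[Pr]_w ((h (M w) (obs_block S U n w) + residual S U Z lam i w) ^+ 2)%:E =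
   \int[Pr]_w ((h (M w) (obs_block S U n w)) ^+ 2)%:E + (N + N')%:E)%E.
Proof.
move=> mh.
have N'0 : 0 <= N' by rewrite divr_ge0 ?mulr_ge0 ?addr_ge0// ltW.
have nu0 : 0 <= N + N' by rewrite addr_ge0// ltW.
have mobs : measurable_fun setT (obs_block S U n).
  by apply: measurable_block => j; exact: measurable_funD.
pose F m (z : n.-tuple R * n.-tuple R) := ((h m z.1 + tnth z.2 i) ^+ 2)%:E.
pose G m (z : n.-tuple R * n.-tuple R) := ((h m z.1) ^+ 2 + (N + N'))%:E.
have mh1 m : measurable_fun setT (fun z : n.-tuple R * n.-tuple R => h m z.1).
  exact: (measurableT_comp (mh m) measurable_fst).
have mF m : measurable_fun setT (F m).
  apply/measurable_EFinP; apply: measurable_funX; apply: measurable_funD => //.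
  exact: (measurableT_comp (measurable_tnth i) measurable_snd).
have mG m : measurable_fun setT (G m).
  apply/measurable_EFinP; apply: measurable_funD => //; exact: measurable_funX.
have F0 m z : (0 <= F m z)%E by rewrite lee_fin sqr_ge0.
have G0 m z : (0 <= G m z)%E by rewrite lee_fin addr_ge0// sqr_ge0.
transitivity (\int[Pr]_w F (M w) (obs_block S U n w, block n (residual S U Z lam) w))%E.
  by apply: eq_integral => w _; rewrite /F/= tnth_mktuple.
transitivity (\int[Pr]_w G (M w) (obs_block S U n w, block n (residual S U Z lam) w))%E.
  rewrite (law_message_obs_residual channel Q0 N0 su20 message mF F0).
  rewrite (law_message_obs_residual channel Q0 N0 su20 message mG G0).
  apply: eq_bigr => m _; congr (_ * _)%E; apply: eq_integral => v _.
  etransitivity; last first.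
    exact/esym/(prob_integral_cst (powm (gauss (N + N')) n) (h m v ^+ 2 + (N + N'))%:E).
  rewrite -(gauss_sqr_add (h m v) nu0).
  apply: (@powm_marginal _ _ (gauss (N + N')) n i (fun x => ((h m v + x) ^+ 2)%:E)).
    by apply/measurable_EFinP; apply: measurable_funX; exact: measurable_funD.
  by move=> x; rewrite lee_fin sqr_ge0.
transitivity (\int[Pr]_w (((h (M w) (obs_block S U n w)) ^+ 2)%:E + (N + N')%:E))%E.
  by apply: eq_integral.
rewrite ge0_integralD//; last 2 first.
- by move=> w _; rewrite lee_fin sqr_ge0.
- apply/measurable_EFinP; apply: measurable_funX.
  exact: measurable_message.
by rewrite prob_integral_cst.
Qed.

Lemma residual_moment2 (i : 'I_n) :
  (\int[Pr]_w (residual S U Z lam i w ^+ 2)%:E = (N + N')%:E)%E.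
Proof.
have := @integral_residual_add (fun _ _ => 0) i (fun _ => @measurable_cst _ _ _ _ _ _).
under eq_integral => w _ do rewrite add0r.
move=> ->; under eq_integral => w _ do rewrite expr0n/=.
by rewrite integral0 add0e.
Qed.

End Moments.

(** * Bounds at a fixed block length *)

Section SumExpect.
Context {d} {Omega : measurableType d} {R : realType} (Pr : probability Omega R).

Local Notation I1 f := (Pr.-integrable setT (EFin \o f)).
Local Notation Ex f := (Rintegral Pr setT f).

Lemma integrable_sumR (I : Type) (s : seq I) (f : I -> Omega -> R) :
  (forall i, I1 (f i)) -> I1 (fun w => \sum_(i <- s) f i w).
Proof.
move=> fi; elim: s => [|i s IHs].
  under eq_fun do rewrite big_nil.
  exact: integrable0.
under eq_fun do rewrite big_cons.
exact: (integrableD measurableT (fi i) IHs).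
Qed.

Lemma expect_sum (I : Type) (s : seq I) (f : I -> Omega -> R) :
  (forall i, I1 (f i)) ->
  Ex (fun w => \sum_(i <- s) f i w) = \sum_(i <- s) Ex (f i).
Proof.
move=> fi; elim: s => [|i s IHs].
  rewrite big_nil -[RHS](expect_cst Pr 0); apply: eq_Rintegral => w _.
  by rewrite big_nil.
rewrite big_cons -IHs -(RintegralD measurableT (fi i) (integrable_sumR s fi)).
by apply: eq_Rintegral => w _; rewrite big_cons.
Qed.

Lemma integrable_llr (a b : R) (f g : Omega -> R) : L2 Pr f -> L2 Pr g ->
  I1 (fun w => llr a b (f w) (g w)).
Proof.
move=> Lf Lg.
apply: (integrableZl measurableT 2^-1
  (f := EFin \o (fun w => ln b - ln a + g w ^+ 2 / b - f w ^+ 2 / a))).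
apply: (integrableB measurableT (f := EFin \o (fun w => ln b - ln a + g w ^+ 2 / b))
  (g := EFin \o (fun w => f w ^+ 2 / a))).
  apply: (integrableD measurableT (f := cst (ln b - ln a)%:E)
    (g := EFin \o (fun w => g w ^+ 2 / b))).
    exact: finite_measure_integrable_cst.
  exact: (integrableZr measurableT b^-1 (L2_sqr Lg)).
exact: (integrableZr measurableT a^-1 (L2_sqr Lf)).
Qed.

Lemma expect_llr (a b : R) (f g : Omega -> R) : L2 Pr f -> L2 Pr g ->
  Ex (fun w => llr a b (f w) (g w)) =
  2^-1 * (ln b - ln a + Ex (fun w => g w ^+ 2) / b - Ex (fun w => f w ^+ 2) / a).
Proof.
move=> Lf Lg.
have i1 : I1 (fun=> ln b - ln a) by exact: finite_measure_integrable_cst.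
have i2 := integrableZr measurableT b^-1 (L2_sqr Lg).
have i3 := integrableZr measurableT a^-1 (L2_sqr Lf).
have i4 := integrableD measurableT i1 i2.
rewrite (RintegralZl _ measurableT (integrableB measurableT i4 i3)).
rewrite (RintegralB measurableT i4 i3) (RintegralD measurableT i1 i2).
rewrite expect_cst (RintegralZr _ measurableT (L2_sqr Lg)).
by rewrite (RintegralZr _ measurableT (L2_sqr Lf)).
Qed.

(** The quadratic terms of [llr] are normalised by the variances: those of [g] sum to exactly n,
    those of [f] to at most n, so only the logarithms remain. Per-letter variances may differ, as
    only their sums enter. *)
Lemma expect_sum_llr n (a b : R) (f g : 'I_n -> Omega -> R) : 0 < a -> 0 < b ->
  (forall i, L2 Pr (f i)) -> (forall i, L2 Pr (g i)) ->
  \sum_(i < n) Ex (fun w => g i w ^+ 2) = n%:R * b ->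
  \sum_(i < n) Ex (fun w => f i w ^+ 2) <= n%:R * a ->
  n%:R / 2 * (ln b - ln a) <= Ex (fun w => \sum_(i < n) llr a b (f i w) (g i w)).
Proof.
move=> a0 b0 Lf Lg Eg Ef.
rewrite expect_sum => [|i]; last exact: integrable_llr.
under eq_bigr do rewrite expect_llr//.
rewrite -mulr_sumr sumrB big_split /= sumr_const card_ord -mulr_suml Eg -mulr_suml.
rewrite mulfK ?gt_eqF// -mulr_natl.
have : (\sum_(i < n) Ex (fun w => f i w ^+ 2)) / a <= n%:R by rewrite ler_pdivrMr.
set s := _ / a; set l := ln b - ln a; lra.
Qed.

End SumExpect.

Section NLetter.
Context {d} {Omega : measurableType d} {R : realType} (Pr : probability Omega R).
Variables (S U Z : nat -> {RV Pr >-> R}) (P Q N su2 : R).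
Hypothesis channel : gaussian_channel S U Z Q N su2.
Hypotheses (Q0 : 0 < Q) (N0 : 0 < N) (su20 : 0 <= su2).
Variables (n k : nat) (M : Omega -> 'I_k) (c : @Defs.code R n k).
Hypothesis message : uniform_message S U Z n M.
Hypotheses (n0 : (0 < n)%N) (power : (avg_power S U c M <= P%:E)%E).

Local Notation I1 f := (Pr.-integrable setT (EFin \o f)).
Local Notation Ex f := (Rintegral Pr setT f).

Let lam := Q / (Q + su2).
Let N' := Q * su2 / (Q + su2).
Let V (i : nat) w := S i w + U i w.
Let T := residual S U Z lam.
Let X (i : 'I_n) w := tnth (input S U c M w) i.
Let Y := output S U Z c M.

Lemma obs_gt0 : 0 < Q + su2. Proof. by rewrite ltr_wpDr. Qed.

Lemma noise_gt0 : 0 < N + N'.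
Proof. by rewrite ltr_wpDr// divr_ge0 ?mulr_ge0// ltW// obs_gt0. Qed.

Lemma measurable_obs : measurable_fun setT (obs_block S U n).
Proof. by apply: measurable_block => j; exact: measurable_funD. Qed.

Lemma measurable_enc m (i : 'I_n) : measurable_fun setT (fun v => tnth (enc c m v) i).
Proof. exact: (measurableT_comp (measurable_tnth i) (enc_measurable c m)). Qed.

Lemma measurable_input (i : 'I_n) : measurable_fun setT (X i).
Proof.
exact: (measurable_message message (fun m => measurable_enc m i) measurable_obs).
Qed.

Lemma sum_input_sqr : (\sum_(i < n) \int[Pr]_w (X i w ^+ 2)%:E <= (n%:R * P)%:E)%E.
Proof.
move: power; rewrite /avg_power lee_pdivrMl ?ltr0n// -EFinM.
by under eq_bigr do rewrite unlock.
Qed.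

Lemma L2_input (i : 'I_n) : L2 Pr (X i).
Proof.
split; first exact: measurable_input.
apply: le_lt_trans (ltry (n%:R * P)); apply: le_trans sum_input_sqr.
rewrite (bigD1 i)//= leeDl// sume_ge0// => j _.
by apply: integral_ge0 => w _; rewrite lee_fin sqr_ge0.
Qed.

Lemma L2_obs i : L2 Pr (V i).
Proof.
split; first exact: measurable_funD.
by rewrite (obs_moment2 channel Q0 N0 su20) ltry.
Qed.

Lemma L2_residual (i : 'I_n) : L2 Pr (T i).
Proof.
split; last by rewrite (residual_moment2 channel Q0 N0 su20 message) ltry.
apply: measurable_funB; first exact: measurable_funD.
by apply: measurable_funM => //; exact: measurable_funD.
Qed.

Lemma expect_obs_sqr i : Ex (fun w => V i w ^+ 2) = Q + su2.
Proof. by rewrite /Rintegral (obs_moment2 channel Q0 N0 su20). Qed.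

Lemma expect_residual_sqr (i : 'I_n) : Ex (fun w => T i w ^+ 2) = N + N'.
Proof. by rewrite /Rintegral (residual_moment2 channel Q0 N0 su20 message). Qed.

(* The average of E[X_i V_i]; rbar is an asymptotic upper bound on it. *)
Definition input_obs_corr : R := (\sum_(i < n) Ex (fun w => X i w * V i w)) / n%:R.

(** The residual adds its variance exactly and the power constraint bounds the input. The lower
    bound serves to show that the upper one is positive, hence usable as a variance. The slope [b]
    will be the optimal one for the rate, and [lam] for the output itself. *)
Lemma sum_expect_sqr (b : R) :
  n%:R * (N + N') <= \sum_(i < n) Ex (fun w => (X i w + b * V i w + T i w) ^+ 2) <=
  n%:R * (P + 2 * b * input_obs_corr + b ^+ 2 * (Q + su2) + (N + N')).
Proof.
have Xb i : L2 Pr (fun w => X i w + b * V i w) by exact: L2D (L2_input i) (L2Z b (L2_obs i)).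
have E i : Ex (fun w => (X i w + b * V i w + T i w) ^+ 2) =
    Ex (fun w => X i w ^+ 2) + 2 * b * Ex (fun w => X i w * V i w) +
    b ^+ 2 * (Q + su2) + (N + N').
  rewrite -(expect_obs_sqr i) -(expect_sqrD b (L2_input i) (L2_obs i)).
  have mh m : measurable_fun setT (fun v : n.-tuple R => tnth (enc c m v) i + b * tnth v i).
    apply: measurable_funD; first exact: measurable_enc.
    by apply: measurable_funM => //; exact: measurable_tnth.
  have := integral_residual_add channel Q0 N0 su20 message i mh.
  under eq_integral => w _ do rewrite tnth_mktuple.
  under [in RHS]eq_integral => w _ do rewrite tnth_mktuple.
  rewrite (L2_integral (Xb i)) (L2_integral (L2D (Xb i) (L2_residual i))).
  by rewrite -EFinD => -[].
apply/andP; split.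
  rewrite (_ : n%:R * _ = \sum_(i < n) (N + N')); last first.
    by rewrite sumr_const card_ord mulr_natl.
  apply: ler_sum => i _; rewrite E lerDr -(expect_obs_sqr i).
  rewrite -(expect_sqrD b (L2_input i) (L2_obs i)).
  by apply: Rintegral_ge0 => w _; exact: sqr_ge0.
rewrite (eq_bigr _ (fun i _ => E i)) !big_split /= !sumr_const card_ord -mulr_sumr.
have -> : \sum_(i < n) Ex (fun w => X i w * V i w) = n%:R * input_obs_corr.
  by rewrite /input_obs_corr mulrC divfK// pnatr_eq0 -lt0n.
have : \sum_(i < n) Ex (fun w => X i w ^+ 2) <= n%:R * P.
  rewrite -lee_fin; apply: le_trans sum_input_sqr.
  by rewrite -sumEFin; apply: lee_sum => i _; rewrite (L2_integral (L2_input i)).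
rewrite -mulrnDl -[(N + N') *+ n]mulr_natl -[(b ^+ 2 * (Q + su2)) *+ n]mulr_natl !mulrDr.
by rewrite !lerD2r [n%:R * (2 * b * _)]mulrCA lerD2r.
Qed.

Lemma outputE w (i : 'I_n) : tnth (Y w) i = X i w + lam * V i w + T i w.
Proof. by rewrite tnth_mktuple /T /residual /X /V; ring. Qed.

Lemma measurable_output : measurable_fun setT Y.
Proof.
apply: measurable_mktuple => i; apply: measurable_funD => //.
by apply: measurable_funD => //; exact: measurable_input.
Qed.

Lemma measurable_error : measurable [set w | dec_msg c (Y w) <> M w].
Proof.
rewrite (_ : [set w | _] = \bigcup_(m in [set: 'I_k])
   (M @^-1` [set m] `&` Y @^-1` (~` (dec_msg c @^-1` [set m])))).
  apply: fin_bigcup_measurable => // m _; apply: measurableI.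
    by case: message => mM _ _; exact: mM.
  rewrite -[X in measurable X]setTI; apply: measurable_output => //.
  by apply: measurableC; exact: dec_msg_measurable.
apply/seteqP; split=> w /=; first by move=> H; exists (M w).
by move=> [m _ [-> ]].
Qed.

Lemma hitE w : hit c (M w) (Y w) =
  ln k%:R * \1_(~` [set w | dec_msg c (Y w) <> M w]) w.
Proof.
rewrite /hit !indicE; congr (_ * (nat_of_bool _)%:R).
apply/idP/idP; rewrite !inE /=; first by move=> ->; exact: id.
by move/contrapT.
Qed.

Lemma integrable_hit : I1 (fun w => hit c (M w) (Y w)).
Proof.
under eq_fun do rewrite hitE.
apply: (integrableZl measurableT (ln k%:R)
  (f := EFin \o \1_(~` [set w | dec_msg c (Y w) <> M w]))).
apply: integrable_indic => //.
by apply: measurableC; exact: measurable_error.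
Qed.

Let Pe := fine (error_prob S U Z c M).

Lemma expect_hit : Ex (fun w => hit c (M w) (Y w)) = ln k%:R * (1 - Pe).
Proof.
have mE := measurable_error; have mEC := measurableC mE.
have iE : I1 (\1_(~` [set w | dec_msg c (Y w) <> M w]) : Omega -> R).
  exact: integrable_indic.
under eq_Rintegral do rewrite hitE.
rewrite (RintegralZl _ measurableT iE); congr (_ * _).
rewrite /Rintegral integral_indic// setIT.
transitivity (fine (1 - Pr [set w | dec_msg c (Y w) <> M w])%E).
  by congr fine; exact: probability_setC.
by rewrite fineB//; exact: fin_num_measure.
Qed.

Lemma n_letter_rate :
  let s2 := P + (N + N') - input_obs_corr ^+ 2 / (Q + su2) in
  0 < s2 /\ ln k%:R * (1 - Pe) - ln 2 <= n%:R / 2 * (ln s2 - ln (N + N')).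
Proof.
(* This slope minimises P + 2 b rb + b^2 (Q + su2), with rb the value of [input_obs_corr]: -b V is
   the best linear prediction of X from V with one coefficient for all letters. *)
move=> s2; pose b := - (input_obs_corr / (Q + su2)).
have q0 := obs_gt0.
have nR : 0 < n%:R :> R by rewrite ltr0n.
have s2E : P + 2 * b * input_obs_corr + b ^+ 2 * (Q + su2) + (N + N') = s2.
  by rewrite /b /s2; field; rewrite gt_eqF.
have /andP[lo hi] := sum_expect_sqr b; rewrite s2E in hi.
have s20 : 0 < s2.
  have := le_trans lo hi; rewrite ler_pM2l// => /(lt_le_trans _); apply.
  exact: noise_gt0.
split=> //.
have LA (i : 'I_n) : L2 Pr (fun w => X i w + b * V i w + T i w).
  exact: L2D (L2D (L2_input i) (L2Z b (L2_obs i))) (L2_residual i).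
have AE (i : 'I_n) w : tnth (Y w) i - (lam - b) * V i w = X i w + b * V i w + T i w.
  by rewrite outputE; ring.
have iL : I1 (fun w => \sum_(i < n) llr s2 (N + N') (X i w + b * V i w + T i w) (T i w)).
  by apply: integrable_sumR => i; exact: integrable_llr (LA i) (L2_residual i).
have eT : \sum_(i < n) Ex (fun w => T i w ^+ 2) = n%:R * (N + N').
  by under eq_bigr do rewrite expect_residual_sqr; rewrite sumr_const card_ord mulr_natl.
have := expect_sum_llr s20 noise_gt0 LA L2_residual eT hi.
have := expect_exp_le2 (integrableD measurableT integrable_hit iL) _.
rewrite (RintegralD measurableT integrable_hit iL) expect_hit => /(_ _)/wrap[].
  have := exp_rate_le2 channel Q0 N0 su20 c message (lam - b) s20.
  by under eq_integral => w _ do under eq_bigr do rewrite AE.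
lra.
Qed.

(** Rate and state estimation share one budget: decoding the message and predicting V to within dv
    rather than Q + su2 together cost at most n / 2 times the logarithm of tau / nu. *)
Lemma n_letter_distortion (b dv : R) : 0 < dv ->
  (forall i : 'I_n, L2 Pr (fun w => V i w - b * tnth (dec_state c (Y w)) i)) ->
  \sum_(i < n) Ex (fun w => (V i w - b * tnth (dec_state c (Y w)) i) ^+ 2) <= n%:R * dv ->
  let tau := P + 2 * lam * input_obs_corr + lam ^+ 2 * (Q + su2) + (N + N') in
  0 < tau /\ ln k%:R * (1 - Pe) - ln 2 <=
    n%:R / 2 * (ln dv - ln (Q + su2) + ln tau - ln (N + N')).
Proof.
move=> dv0 LS ES tau.
have nR : 0 < n%:R :> R by rewrite ltr0n.
have /andP[lo hi] := sum_expect_sqr lam; rewrite -/tau in hi.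
have tau0 : 0 < tau.
  have := le_trans lo hi; rewrite ler_pM2l// => /(lt_le_trans _); apply.
  exact: noise_gt0.
split=> //.
have LA (i : 'I_n) : L2 Pr (fun w => X i w + lam * V i w + T i w).
  exact: L2D (L2D (L2_input i) (L2Z lam (L2_obs i))) (L2_residual i).
have iL : I1 (fun w => \sum_(i < n) llr tau (N + N') (X i w + lam * V i w + T i w) (T i w)).
  by apply: integrable_sumR => i; exact: integrable_llr (LA i) (L2_residual i).
have iS : I1 (fun w => \sum_(i < n) llr dv (Q + su2)
    (V i w - b * tnth (dec_state c (Y w)) i) (V i w)).
  by apply: integrable_sumR => i; exact: integrable_llr (LS i) (L2_obs i).
have eT : \sum_(i < n) Ex (fun w => T i w ^+ 2) = n%:R * (N + N').
  by under eq_bigr do rewrite expect_residual_sqr; rewrite sumr_const card_ord mulr_natl.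
have eV : \sum_(i < n) Ex (fun w => V i w ^+ 2) = n%:R * (Q + su2).
  by under eq_bigr do rewrite expect_obs_sqr; rewrite sumr_const card_ord mulr_natl.
have := expect_sum_llr tau0 noise_gt0 LA L2_residual eT hi.
have := expect_sum_llr dv0 obs_gt0 LS (fun i : 'I_n => L2_obs i) eV ES.
have iHS := integrableD measurableT integrable_hit iS.
have := expect_exp_le2 (integrableD measurableT iHS iL) _.
rewrite (RintegralD measurableT iHS iL) (RintegralD measurableT integrable_hit iS).
rewrite expect_hit => /(_ _)/wrap[].
  have := exp_distortion_le2 channel Q0 N0 su20 c message b dv0 tau0.
  by under eq_integral => w _ do under [X in _ + X]eq_bigr do rewrite outputE.
lra.
Qed.

End NLetter.

Section StateEstimate.
Context {d} {Omega : measurableType d} {R : realType} (Pr : probability Omega R).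
Variables (S U Z : nat -> {RV Pr >-> R}) (P Q N su2 : R).
Hypothesis channel : gaussian_channel S U Z Q N su2.
Hypotheses (Q0 : 0 < Q) (N0 : 0 < N) (su20 : 0 <= su2).
Variables (n k : nat) (M : Omega -> 'I_k) (c : @Defs.code R n k).
Hypothesis message : uniform_message S U Z n M.
Hypotheses (n0 : (0 < n)%N) (power : (avg_power S U c M <= P%:E)%E).
Variable D : R.
Hypotheses (D0 : 0 < D) (distortion : (avg_distortion S U Z c M <= D%:E)%E).

Local Notation Ex f := (Rintegral Pr setT f).

Let lam := Q / (Q + su2).
Let N' := Q * su2 / (Q + su2).
Let V (i : nat) w := S i w + U i w.
Let Err (i : 'I_n) w := S i w - tnth (dec_state c (output S U Z c M w)) i.

Lemma L2_state i : L2 Pr (S i).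
Proof.
split; first by [].
by case: channel => iS _ _ _; rewrite (iid_gaussian_moment2 i (ltW Q0) iS) ltry.
Qed.

Lemma expect_state_sqr i : Ex (fun w => S i w ^+ 2) = Q.
Proof.
by case: channel => iS _ _ _; rewrite /Rintegral (iid_gaussian_moment2 i (ltW Q0) iS).
Qed.

Lemma expect_obs_scaled_state (b : R) i :
  Ex (fun w => (V i w - b * S i w) ^+ 2) = (Q + su2) - 2 * b * Q + b ^+ 2 * Q.
Proof.
have LV := L2_obs channel Q0 N0 su20 i.
have LS := L2_state i.
have E e := expect_sqrD e LV LS.
(* The cross moment comes from expanding the square of V - S = U, whose second moment is known. *)
have VS : Ex (fun w => V i w * S i w) = Q.
  have := E (-1).
  rewrite (expect_obs_sqr channel Q0 N0 su20) expect_state_sqr.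
  have -> : Ex (fun w => (V i w + -1 * S i w) ^+ 2) = su2.
    case: channel => _ _ iU _.
    transitivity (Ex (fun w => U i w ^+ 2)).
      by apply: eq_Rintegral => w _; rewrite /V; congr (_ ^+ 2); ring.
    by rewrite /Rintegral (iid_gaussian_moment2 i su20 iU).
  lra.
have := E (- b); rewrite (expect_obs_sqr channel Q0 N0 su20) expect_state_sqr VS sqrrN.
under eq_Rintegral do rewrite mulNr.
by move=> ->; ring.
Qed.

Lemma sum_error_sqr : (\sum_(i < n) \int[Pr]_w (Err i w ^+ 2)%:E <= (n%:R * D)%:E)%E.
Proof.
move: distortion; rewrite /avg_distortion lee_pdivrMl ?ltr0n// -EFinM.
by under eq_bigr do rewrite unlock.
Qed.

Lemma L2_error (i : 'I_n) : L2 Pr (Err i).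
Proof.
split.
  apply: measurable_funB => //; apply: (measurableT_comp (measurable_tnth i)).
  apply: (measurableT_comp (dec_state_measurable c)).
  exact: measurable_output message.
apply: le_lt_trans (ltry (n%:R * D)); apply: le_trans sum_error_sqr.
rewrite (bigD1 i)//= leeDl// sume_ge0// => j _.
by apply: integral_ge0 => w _; rewrite lee_fin sqr_ge0.
Qed.

(** V - b Shat = (V - b S) + b (S - Shat), and Young's inequality with weight [eta] bounds the
    square letter by letter. The first part has a known second moment, the second is controlled by
    the distortion. *)
Lemma n_letter_state_distortion (b eta : R) : 0 < eta ->
  let dv := (1 + eta) * ((Q + su2) - 2 * b * Q + b ^+ 2 * Q) +
            (1 + eta^-1) * (b ^+ 2 * D) in
  let tau := P + 2 * lam * input_obs_corr S U M c +
             lam ^+ 2 * (Q + su2) + (N + N') in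
  [/\ 0 < dv, 0 < tau & ln k%:R * (1 - fine (error_prob S U Z c M)) - ln 2 <=
    n%:R / 2 * (ln dv - ln (Q + su2) + ln tau - ln (N + N'))].
Proof.
move=> eta0 dv tau.
have LVS (i : 'I_n) : L2 Pr (fun w => V i w - b * S i w).
  exact: L2B (L2_obs channel Q0 N0 su20 i) (L2Z b (L2_state i)).
have LE (i : 'I_n) : L2 Pr (fun w => b * Err i w) by exact: L2Z (L2_error i).
have VE (i : 'I_n) w : V i w - b * tnth (dec_state c (output S U Z c M w)) i =
    (V i w - b * S i w) + b * Err i w by rewrite /Err; ring.
have k0 : 0 <= (Q + su2) - 2 * b * Q + b ^+ 2 * Q.
  rewrite -(expect_obs_scaled_state b 0).
  by apply: Rintegral_ge0 => w _; exact: sqr_ge0.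
have dv0 : 0 < dv.
  (* To be a variance, [dv] must be positive: the first summand ensures it when b = 0, the second,
     through D > 0, otherwise. *)
  have [b0|b0] := eqVneq b 0.
    rewrite (_ : dv = (1 + eta) * (Q + su2)); last by rewrite /dv b0; ring.
    by rewrite mulr_gt0//; [rewrite addr_gt0|rewrite ltr_wpDr].
  have i0 : 0 < eta^-1 by rewrite invr_gt0.
  apply: ltr_wpDl; first by rewrite mulr_ge0// addr_ge0// ltW.
  apply: mulr_gt0; first by rewrite addr_gt0.
  by rewrite mulr_gt0// exprn_even_gt0.
have LT (i : 'I_n) : L2 Pr (fun w => V i w - b * tnth (dec_state c (output S U Z c M w)) i).
  have := L2D (LVS i) (LE i).
  by under [X in L2 _ X -> _]eq_fun do rewrite -VE.
have bound (i : 'I_n) :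
    Ex (fun w => (V i w - b * tnth (dec_state c (output S U Z c M w)) i) ^+ 2) <=
    (1 + eta) * ((Q + su2) - 2 * b * Q + b ^+ 2 * Q) +
    (1 + eta^-1) * b ^+ 2 * Ex (fun w => Err i w ^+ 2).
  have i1 := integrableZl measurableT (1 + eta) (L2_sqr (LVS i)).
  have i2 := integrableZl measurableT ((1 + eta^-1) * b ^+ 2) (L2_sqr (L2_error i)).
  rewrite -(expect_obs_scaled_state b i) -(RintegralZl _ measurableT (L2_sqr (LVS i))).
  rewrite -(RintegralZl _ measurableT (L2_sqr (L2_error i))).
  rewrite -(RintegralD measurableT i1 i2).
  apply: (le_Rintegral measurableT (L2_sqr (LT i)) (integrableD measurableT i1 i2)) => w _.
  rewrite VE; move: (V i w - _) (Err i w) => x y.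
  have := mulr_ge0 (ltW eta0) (sqr_ge0 (x - b * y / eta)).
  have -> : eta * (x - b * y / eta) ^+ 2 = eta * x ^+ 2 - 2 * (x * (b * y)) + eta^-1 * b ^+ 2 * y ^+ 2.
    by field; rewrite gt_eqF.
  have -> : (x + b * y) ^+ 2 = x ^+ 2 + 2 * (x * (b * y)) + b ^+ 2 * y ^+ 2 by ring.
  rewrite !mulrDl !mul1r; lra.
have sumE : \sum_(i < n) Ex (fun w => Err i w ^+ 2) <= n%:R * D.
  rewrite -lee_fin; apply: le_trans sum_error_sqr.
  by rewrite -sumEFin; apply: lee_sum => i _; rewrite (L2_integral (L2_error i)).
have hi : \sum_(i < n) Ex (fun w =>
    (V i w - b * tnth (dec_state c (output S U Z c M w)) i) ^+ 2) <= n%:R * dv.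
  apply: le_trans (ler_sum _ (fun i _ => bound i)) _.
  have -> : n%:R * dv = ((1 + eta) * ((Q + su2) - 2 * b * Q + b ^+ 2 * Q)) *+ n +
      (1 + eta^-1) * b ^+ 2 * (n%:R * D) by rewrite -[_ *+ n]mulr_natl /dv; ring.
  rewrite big_split /= sumr_const card_ord -mulr_sumr lerD2l.
  apply: ler_wpM2l => //.
  by rewrite mulr_ge0 ?sqr_ge0// addr_ge0// invr_ge0 ltW.
by have [] := n_letter_distortion channel Q0 N0 su20 message n0 power dv0 LT hi; split.
Qed.

End StateEstimate.

(** * From an estimate of the observed state to an estimate of the state *)

Section Geometry.
Context {R : realType}.

(** The infimum over eta of the right-hand side is (a + b)^2, so the family of inequalities amounts
    to the triangle inequality. *)
Lemma sqrt_le_of_young (a b x : R) : 0 <= a -> 0 <= b ->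
  (forall eta, 0 < eta -> x <= (1 + eta) * a ^+ 2 + (1 + eta^-1) * b ^+ 2) ->
  Num.sqrt x <= a + b.
Proof.
move=> a0 b0 H; apply/ler_addgt0Pr => e e0.
(* For positive lengths the optimal weight is eta = b / a; the added e / 2 keeps it defined and
   positive when a or b is 0. *)
pose u := a + e / 2; pose v := b + e / 2.
have e20 : 0 < e / 2 by rewrite divr_gt0.
have u0 : 0 < u by rewrite ltr_wpDl.
have v0 : 0 < v by rewrite ltr_wpDl.
have -> : a + b + e = u + v by rewrite /u /v; field.
rewrite -(ger0_norm (addr_ge0 (ltW u0) (ltW v0))) -sqrtr_sqr ler_wsqrtr//.
apply: (le_trans (H (v / u) (divr_gt0 v0 u0))).
have -> : (u + v) ^+ 2 = (1 + v / u) * u ^+ 2 + (1 + (v / u)^-1) * v ^+ 2.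
  by field; rewrite !gt_eqF.
have au : a <= u by rewrite lerDl ltW.
have bv : b <= v by rewrite lerDl ltW.
apply: lerD; apply: ler_wpM2l; rewrite ?lerXn2r ?nnegrE ?(ltW u0) ?(ltW v0)//.
  by rewrite addr_ge0// divr_ge0// ltW.
by rewrite addr_ge0// invr_ge0 divr_ge0// ltW.
Qed.

(* In L2, the state is S' + W with S' and W orthogonal of squared norms Q' and
   N', and K t = (1 - t)^2 Q' + t^2 N' is the squared distance from S' to t (S' + W).  An estimate at
   distance sqrt D from the state is, after scaling by t, at distance at most
   sqrt (K t) + t sqrt D from S'; the bound comes from the best t.  The factors
   1 + eta and 1 + 1 / eta stand for the triangle inequality. *)
Lemma distortion_bound_le (Q' N' x D : R) : 0 < Q' -> 0 <= N' -> 0 <= x -> 0 <= D ->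
  (forall t eta, 0 < eta ->
    x <= (1 + eta) * ((1 - t) ^+ 2 * Q' + t ^+ 2 * N') + (1 + eta^-1) * (t ^+ 2 * D)) ->
  distortion_bound Q' N' x <= D.
Proof.
move=> Q0 N0 x0 D0 H.
(* At t = 0 the hypothesis does not involve D and reads x <= (1 + eta) Q'. *)
have xQ : x <= Q'.
  apply/ler_addgt0Pr => e e0; have eQ : 0 < e / Q' by rewrite divr_gt0.
  have := H 0 _ eQ; rewrite subr0 expr1n !expr0n/= !mul0r mulr0 !addr0 mul1r mulrDl mul1r.
  by rewrite divfK// gt_eqF.
rewrite /distortion_bound; set y := Num.sqrt x - _.
suff yD : y <= Num.sqrt D.
  rewrite -(sqr_sqrtr D0) lerXn2r ?nnegrE ?sqrtr_ge0 ?le_max ?lexx ?orbT//.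
  by rewrite ge_max yD sqrtr_ge0.
(* At x = Q' the t used below degenerates to 0, where D drops out of the hypothesis; that case is
   treated by letting t tend to 0. *)
have [xltQ|xeQ] : x < Q' \/ x = Q' by move: xQ; rewrite le_eqVlt => /predU1P[]; tauto.
  pose q := Num.sqrt Q'; pose m := Num.sqrt N'; pose s := Num.sqrt x.
  pose c := Num.sqrt (Q' - x); pose g := Num.sqrt D.
  have q0 : 0 < q by rewrite sqrtr_gt0.
  have m0 : 0 <= m by exact: sqrtr_ge0.
  have s0 : 0 <= s by exact: sqrtr_ge0.
  have g0 : 0 <= g by exact: sqrtr_ge0.
  have c0 : 0 < c by rewrite sqrtr_gt0 subr_gt0.
  have qE : q ^+ 2 = Q' by rewrite sqr_sqrtr// ltW.
  have mE : m ^+ 2 = N' by rewrite sqr_sqrtr.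
  have gE : g ^+ 2 = D by rewrite sqr_sqrtr.
  have scE : s ^+ 2 + c ^+ 2 = q ^+ 2.
    by rewrite !sqr_sqrtr ?subr_ge0// ?(ltW Q0)// addrC subrK.
  have w0 : 0 < q * c + m * s by rewrite ltr_wpDr ?mulr_gt0 ?mulr_ge0.
  (* The triangle inequality gives sqrt D >= (s - sqrt (K t)) / t, with K t the squared distance
     described above. This t is the stationary point of the right-hand side in t; the local [K] is
     the square root of the squared distance there. *)
  pose t := q * c / (q * c + m * s).
  have t0 : 0 <= t by rewrite divr_ge0 ?mulr_ge0 ?ltW.
  pose K := m * q ^+ 2 / (q * c + m * s).
  have K0 : 0 <= K by rewrite divr_ge0 ?mulr_ge0 ?sqr_ge0// ltW.
  have KE : (1 - t) ^+ 2 * Q' + t ^+ 2 * N' = K ^+ 2.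
    rewrite -qE -mE.
    have -> : K ^+ 2 = (m * q) ^+ 2 * (s ^+ 2 + c ^+ 2) / (q * c + m * s) ^+ 2.
      by rewrite scE /K; field; rewrite gt_eqF.
    by rewrite /t; field; rewrite gt_eqF.
  have : s <= K + t * g.
    apply: sqrt_le_of_young => [//||eta eta0]; first exact: mulr_ge0.
    by rewrite -KE [(t * g) ^+ 2]exprMn gE; exact: H.
  have -> : K + t * g = (m * q ^+ 2 + q * c * g) / (q * c + m * s).
    by rewrite /K /t; field; rewrite gt_eqF.
  rewrite ler_pdivlMr// => sK.
  have -> : y = s - m / q * c.
    by rewrite /y sqrtrM// sqrtrV// ltW.
  rewrite lerBlDl -/g -(ler_pM2r (mulr_gt0 q0 c0)).
  have -> : (m / q * c + g) * (q * c) = m * c ^+ 2 + q * c * g by field; rewrite gt_eqF.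
  have : m * q ^+ 2 = m * s ^+ 2 + m * c ^+ 2 by rewrite -mulrDr scE.
  move: sK; rewrite mulrDr => sK E; rewrite E in sK.
  have : s * (m * s) = m * s ^+ 2 by ring.
  lra.
rewrite /y xeQ subrr sqrtr0 mulr0 subr0 ler_wsqrtr//.
apply/ler_addgt0Pr => e e0.
pose C := D + 2 * N' + 1.
have C0 : 0 < C by rewrite ltr_wpDl// addr_ge0// mulr_ge0.
(* With eta = t and after division by t, the hypothesis becomes Q' <= D up to terms of order t,
   whose coefficient is bounded by [C]; the + 1 in [C] keeps it positive. *)
pose t := Num.min 1 (e / C).
have t0 : 0 < t by rewrite lt_min ltr01 divr_gt0.
have t1 : t <= 1 by rewrite ge_min lexx.
have tC : t * C <= e by rewrite -ler_pdivlMr// ge_min lexx orbT.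
have := H t t t0; rewrite xeQ.
have -> : (1 + t^-1) * (t ^+ 2 * D) = t * (D + t * D) by field; rewrite gt_eqF.
have -> : (1 + t) * ((1 - t) ^+ 2 * Q' + t ^+ 2 * N') =
  Q' - t * Q' + t * (- t * (1 - t) * Q' + (1 + t) * (t * N')) by ring.
move=> I.
have : t * Q' <= t * (- t * (1 - t) * Q' + (1 + t) * (t * N') + (D + t * D)).
  by rewrite mulrDr; lra.
rewrite ler_pM2l// => J; apply: (le_trans J).
have j1 : 0 <= t * (1 - t) * Q' by rewrite !mulr_ge0 ?subr_ge0// ltW.
have j2 : (1 + t) * (t * N') <= 2 * (t * N').
  by apply: ler_wpM2r; [rewrite mulr_ge0// ltW|lra].
have j3 : t * C = t * D + 2 * (t * N') + t by rewrite /C; ring.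
rewrite !mulNr; lra.
Qed.

End Geometry.

(** * Limits *)

Section Limits.
Context {R : realType}.

Lemma le_at_right0 (f g : R -> R) : {for 0, continuous f} -> {for 0, continuous g} ->
  (forall e, 0 < e -> f e <= g e) -> f 0 <= g 0.
Proof.
move=> cf cg fg.
apply: (@ler_cvg_to _ (0^'+) _ _ f g).
- exact: cvg_at_right_filter.
- exact: cvg_at_right_filter.
- near=> e; apply: fg; near: e; exact: nbhs_right_gt.
Unshelve. all: by end_near. Qed.

Lemma ln_msg_count (r : R) n : 0 <= r -> n%:R * r * ln 2 <= ln (msg_count r n)%:R.
Proof.
move=> r0; rewrite /msg_count natrX lnXn// -[ln _ *+ _]mulr_natl ler_wpM2r ?ln_ge0 ?ler1n//.
have nr0 : 0 <= n%:R * r by rewrite mulr_ge0.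
rewrite natr_absz ger0_norm.
  exact: ceil_ge.
by rewrite ceil_ge0 (lt_le_trans _ nr0).
Qed.

Lemma limn_esup_le_near (u : (\bar R)^nat) (l m : \bar R) :
  (limn_esup u <= l)%E -> (l < m)%E -> \forall n \near \oo, (u n <= m)%E.
Proof.
move=> ul lm; have : (limn_esup u < m)%E by exact: le_lt_trans lm.
rewrite limn_esup_lim (cvg_lim _ (@cvg_esups_inf _ u))// => /ereal_inf_lt[_ [n _ <-] un].
exists n => // p /= np; apply: (le_trans _ (ltW un)).
by apply: ereal_sup_ubound; exists p.
Qed.

(** The gap between h and r ln 2 absorbs both losses per letter: the constant ln 2, divided by n,
    and the vanishing error probability. *)
Lemma eventually_rate (r h : R) (k : nat -> nat) (e : nat -> \bar R) : 0 <= r ->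
  h < r * ln 2 -> (forall n, k n = msg_count r n) -> e n @[n --> \oo] --> 0%E ->
  (forall n, (e n <= 1)%E) ->
  \forall n \near \oo, n%:R * h <= ln (k n)%:R * (1 - fine (e n)) - ln 2.
Proof.
move=> r0 hr kE e0 e1.
pose g := r * ln 2 - h.
have g0 : 0 < g by rewrite subr_gt0.
have l2 : 0 < ln 2 :> R by rewrite ln_gt0// ltr1n.
have rl0 : 0 <= r * ln 2 by rewrite mulr_ge0// ltW.
have /fine_cvgP[_ fe0] := e0.
(* Half of the gap pays for the error probability, half for ln 2. The + 1 keeps the denominator
   positive when r = 0. *)
have d0 : 0 < g / 2 / (r * ln 2 + 1) by rewrite !divr_gt0// ltr_wpDl.
near=> n.
have fe : fine (e n) <= g / 2 / (r * ln 2 + 1).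
  by near: n; exact: (cvgr_le _ fe0).
have n2 : ln 2 / (g / 2) < n%:R by near: n; exact: nbhs_infty_gtr.
have f1 : fine (e n) <= 1.
  by case: (e n) (e1 n) => //= x; rewrite lee_fin.
(* Only a lower bound on ln k is available, so the factor 1 - e_n has to be nonnegative. *)
have k1 : n%:R * r * ln 2 * (1 - fine (e n)) <= ln (k n)%:R * (1 - fine (e n)).
  by rewrite ler_wpM2r ?subr_ge0// kE ln_msg_count.
apply: (@le_trans _ _ (n%:R * r * ln 2 * (1 - fine (e n)) - ln 2)); last by rewrite lerD2r.
have rf : r * ln 2 * fine (e n) <= g / 2.
  apply: (@le_trans _ _ (r * ln 2 * (g / 2 / (r * ln 2 + 1)))); first exact: ler_wpM2l.
  rewrite mulrA ler_pdivrMr ?ltr_wpDl// [leLHS]mulrC ler_wpM2l ?divr_ge0 ?(ltW g0)//.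
  by rewrite lerDl.
have : n%:R * (r * ln 2 * fine (e n)) <= n%:R * (g / 2) by exact: ler_wpM2l.
move: n2; rewrite ltr_pdivrMr ?divr_gt0// => n2.
have -> : n%:R * r * ln 2 * (1 - fine (e n)) =
  n%:R * (r * ln 2) - n%:R * (r * ln 2 * fine (e n)) by ring.
have -> : n%:R * h = n%:R * (r * ln 2) - 2 * (n%:R * (g / 2)).
  by rewrite /g; field.
lra.
Unshelve. all: by end_near. Qed.

End Limits.

(** * Limit of the block bounds and choice of rbar *)

Section Converse.
Variables (R : realType) (P Q N su2 : R).
Hypotheses (P0 : 0 < P) (Q0 : 0 < Q) (N0 : 0 < N) (su20 : 0 <= su2).
Variables (d : measure_display) (Omega : measurableType d) (Pr : probability Omega R)
  (S U Z : nat -> {RV Pr >-> R}).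
Hypothesis channel : gaussian_channel S U Z Q N su2.
Variables (r D : R) (M : forall n : nat, Omega -> 'I_(msg_count r n)).
Hypotheses (r0 : 0 <= r)
  (message : forall n : nat, uniform_message S U Z n (M n))
  (rD_achievable : achievable S U Z P M D).

Let lam := Q / (Q + su2).
Let N' := Q * su2 / (Q + su2).
Let nu := N + N'.

(* [corr2 y] bounds the square of [input_obs_corr] when y is a lower bound on
   2 ^ (2 R_n), R_n being the rate of correctly decoded information at block
   length n. *)
Let corr2 (y : R) := (Q + su2) * (P + nu - nu * y).

Let obs0 : 0 < Q + su2. Proof. by rewrite ltr_wpDr. Qed.
Let nu0 : 0 < nu. Proof. exact: noise_gt0. Qed.

(** A single sufficiently long block is enough: once the decoded information is at least n h, the
    length cancels from both bounds. The block is chosen before [b] and [eta], which therefore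
    remain free. *)
Lemma achievable_approx (h D' : R) : h < r * ln 2 -> D < D' -> 0 < D' ->
  0 <= corr2 (expR (2 * h)) /\
  forall b eta, 0 < eta ->
    expR (2 * h) * ((Q + su2) * nu) <=
    ((1 + eta) * ((Q + su2) - 2 * b * Q + b ^+ 2 * Q) + (1 + eta^-1) * (b ^+ 2 * D')) *
    (P + Q + N + 2 * lam * Num.sqrt (corr2 (expR (2 * h)))).
Proof.
move=> hr DD' D'0; case: rD_achievable => c [power err dist].
have D1 D2 (DD2 : D < D2) := limn_esup_le_near dist (DD2 : (D%:E < D2%:E)%E).
have D2 : \forall n \near \oo, n%:R * h <=
    ln (msg_count r n)%:R * (1 - fine (error_prob S U Z (c n) (M n))) - ln 2.
  apply: (@eventually_rate R r h (msg_count r)) => // n.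
  by apply: probability_le1; exact: measurable_error (message n).
have [n [[n0 rate] dist']] :=
  filter_ex (filterI (filterI (nbhs_infty_gt 0) D2) (D1 _ DD')).
have nR : 0 < n%:R :> R by rewrite ltr0n.
have lnle (a b : R) : 0 < a -> 0 < b -> n%:R * h <= n%:R / 2 * (ln a - ln b) ->
    expR (2 * h) * b <= a.
  move=> a0 b0; rewrite -mulrA ler_pM2l// ler_pdivlMl// lerBrDr.
  move=> H; rewrite -[leRHS](lnK (a0 : a \is Num.pos)).
  by rewrite -[X in _ * X](lnK (b0 : b \is Num.pos)) -expRD ler_expR.
have [s20 rate1] := n_letter_rate channel Q0 N0 su20 (message n) n0 (power n).
have := lnle _ _ s20 nu0 (le_trans rate rate1).
set rb := input_obs_corr S U (M n) (c n) => rate2.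
have rb2 : rb ^+ 2 <= corr2 (expR (2 * h)).
  rewrite /corr2 -ler_pdivrMl// [_^-1 * _]mulrC.
  by move: rate2; rewrite -/N' -/nu; set u := expR _; rewrite [u * nu]mulrC; lra.
split; first exact: le_trans (sqr_ge0 _) rb2.
move=> b eta eta0.
have [] := n_letter_state_distortion channel Q0 N0 su20 (message n) n0 (power n)
  D'0 dist' b eta0.
rewrite -/lam -/N' -/nu -/rb; set dv := (_ + _ * (_ * D')) => dv0.
set tau := P + _ + _ + _ => tau0 rate3.
have := lnle (dv * tau) ((Q + su2) * nu) (mulr_gt0 dv0 tau0) (mulr_gt0 obs0 nu0).
rewrite !lnM ?posrE// => /(_ _)/wrap[].
  by apply: le_trans rate _; apply: le_trans rate3 _; rewrite le_eqVlt; apply/orP; left; apply/eqP; ring.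
(* The sign of [rb] is unknown: it is bounded by its absolute value, hence by the square root of
   [corr2]. *)
move=> H; apply: (le_trans H); apply: ler_wpM2l; first exact: ltW.
have -> : tau = P + Q + N + 2 * lam * rb.
  by rewrite /tau /nu /N' /lam; field; rewrite gt_eqF.
have lam0 : 0 <= lam by rewrite divr_ge0// ltW.
rewrite lerD2l; apply: ler_wpM2l; first by rewrite mulr_ge0.
by rewrite (le_trans (ler_norm rb))// -sqrtr_sqr ler_wsqrtr.
Qed.

Lemma distortion_ge0 : 0 <= D.
Proof.
case: rD_achievable => c [_ _ dist]; apply/ler_addgt0Pr => e e0.
have De : (D%:E < (D + e)%:E)%E by rewrite lte_fin ltrDl.
have [n] := filter_ex (limn_esup_le_near dist De).
rewrite -lee_fin; apply: le_trans.
apply: mule_ge0; first by rewrite lee_fin invr_ge0.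
apply: sume_ge0 => i _; apply: expectation_ge0 => w; exact: sqr_ge0.
Qed.

(** [achievable_approx] at rate r ln 2 - e and distortion D + e, then e -> 0 from the right. For
    fixed [b] and [eta] both sides are continuous in e, and D + e is positive even if D = 0. *)
Lemma achievable_limit :
  0 <= corr2 (expR (2 * (r * ln 2))) /\
  forall b eta, 0 < eta ->
    expR (2 * (r * ln 2)) * ((Q + su2) * nu) <=
    ((1 + eta) * ((Q + su2) - 2 * b * Q + b ^+ 2 * Q) + (1 + eta^-1) * (b ^+ 2 * D)) *
    (P + Q + N + 2 * lam * Num.sqrt (corr2 (expR (2 * (r * ln 2))))).
Proof.
set L := r * ln 2.
have cE : {for 0, continuous (fun e : R => expR (2 * (L - e)))}.
  apply: (@continuous_comp _ _ _ (fun e : R => 2 * (L - e)) expR); last exact: continuous_expR.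
  by apply: cvgM; [exact: cvg_cst|apply: cvgB; [exact: cvg_cst|exact: cvg_id]].
have cG : {for 0, continuous (fun e : R => corr2 (expR (2 * (L - e))))}.
  apply: cvgM; first exact: cvg_cst.
  apply: cvgB; first exact: cvg_cst.
  by apply: cvgM; [exact: cvg_cst|exact: cE].
have approx e : 0 < e -> _ := fun e0 => @achievable_approx (L - e) (D + e)
  ltac:(by rewrite ltrBlDr ltrDl) ltac:(by rewrite ltrDl)
  ltac:(by rewrite ltr_wpDl// distortion_ge0).
split.
  have := @le_at_right0 R (cst 0) (fun e => corr2 (expR (2 * (L - e)))) (cvg_cst _) cG.
  by rewrite subr0; apply => e e0; have [] := approx _ e0.
move=> b eta eta0.
pose f e := expR (2 * (L - e)) * ((Q + su2) * nu).
pose g e := ((1 + eta) * ((Q + su2) - 2 * b * Q + b ^+ 2 * Q) + (1 + eta^-1) * (b ^+ 2 * (D + e))) *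
    (P + Q + N + 2 * lam * Num.sqrt (corr2 (expR (2 * (L - e))))).
have cf : {for 0, continuous f} by apply: cvgM; [exact: cE|exact: cvg_cst].
have cg : {for 0, continuous g}.
  apply: cvgM.
    apply: cvgD; first exact: cvg_cst.
    apply: cvgM; first exact: cvg_cst.
    apply: cvgM; first exact: cvg_cst.
    by apply: cvgD; [exact: cvg_cst|exact: cvg_id].
  apply: cvgD; first exact: cvg_cst.
  apply: cvgM; first exact: cvg_cst.
  apply: (@continuous_comp _ _ _ (fun e : R => corr2 (expR (2 * (L - e)))) Num.sqrt) => //.
  exact: sqrt_continuous.
have := le_at_right0 cf cg; rewrite /f /g subr0 addr0; apply => e e0.
by have [_] := approx _ e0; apply.
Qed.

Lemma converse_bounds :
  let Q' := Q ^+ 2 / (Q + su2) in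
  exists rbar : R,
    [/\ 0 <= rbar <= Num.sqrt (P * (Q + su2)),
        r <= 2^-1 * log2 ((su2 * (N + P + Q) + Q * (N + P) - rbar ^+ 2)
                          / ((Q + su2) * (N + N'))) &
        distortion_bound Q' N'
          (Q' * (N + N') / (P + Q + N + 2 * lam * rbar) * (2 `^ (2 * r))) <= D].
Proof.
move=> Q'; have [G0 bound] := achievable_limit.
have l2 : 0 < ln 2 :> R by rewrite ln_gt0// ltr1n.
have lam0 : 0 < lam by rewrite divr_gt0.
have N'0 : 0 <= N' by rewrite divr_ge0 ?mulr_ge0// ltW.
have Q'0 : 0 < Q' by rewrite divr_gt0 ?exprn_gt0.
have EE : 2 `^ (2 * r) = expR (2 * (r * ln 2)) by rewrite /powR pnatr_eq0/= mulrA.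
have E1 : 1 <= expR (2 * (r * ln 2)).
  by rewrite -[leLHS]expR0 ler_expR !mulr_ge0// ltW.
move: G0 bound; rewrite -EE; rewrite -EE in E1.
set E := 2 `^ _ in E1 *; set G := corr2 _ => G0 bound.
have E0 : 0 < E := lt_le_trans ltr01 E1.
(* Since G >= 0 by [achievable_limit], the square of this witness is G itself, not its
   truncation. *)
exists (Num.sqrt G); have rho0 := sqrtr_ge0 G; split.
- rewrite rho0 ler_wsqrtr//.
  (* The upper bound on rbar comes from r >= 0: as 2^(2r) >= 1, G is at most (Q + su2) P. *)
  have H : nu <= nu * E by rewrite ler_peMr// ltW.
  by rewrite /G /corr2 [P * _]mulrC ler_pM2l//; lra.
- rewrite sqr_sqrtr//.
  have -> : (su2 * (N + P + Q) + Q * (N + P) - G) / ((Q + su2) * (N + N')) = E.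
    rewrite /G /corr2 /nu.
    have -> : su2 * (N + P + Q) + Q * (N + P) = (Q + su2) * (P + (N + N')).
      by rewrite /N'; field; rewrite gt_eqF.
    by rewrite -/nu; field; rewrite !gt_eqF.
  rewrite /log2 /E ln_powR.
  by rewrite (_ : 2^-1 * (2 * r * ln 2 / ln 2) = r)//; field; rewrite gt_eqF.
have tau0 : 0 < P + Q + N + 2 * lam * Num.sqrt G.
  by apply: ltr_wpDr; [rewrite mulr_ge0// mulr_ge0// ltW|rewrite !addr_gt0].
apply: distortion_bound_le => //.
- exact/ltW/(mulr_gt0 (divr_gt0 (mulr_gt0 Q'0 nu0) tau0) E0).
- exact: distortion_ge0.
(* Multiplied by lam, the estimate b Shat of V with b = t / lam becomes the estimate t Shat of lam
   V, the component of S of variance Q'. Scaling the bound by lam^2 thus gives the hypothesis of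
   [distortion_bound_le]. *)
move=> t eta eta0; have := bound (t / lam) eta eta0.
rewrite -ler_pdivrMr// -(ler_pM2l (exprn_gt0 2 lam0)).
move: tau0; set tau := P + Q + N + _ => tau0.
have -> : lam ^+ 2 * (E * ((Q + su2) * nu) / tau) = Q' * (N + N') / tau * E.
  by rewrite /Q' /lam /nu; field; rewrite !gt_eqF.
have -> : lam ^+ 2 * ((1 + eta) * (Q + su2 - 2 * (t / lam) * Q + (t / lam) ^+ 2 * Q) +
    (1 + eta^-1) * ((t / lam) ^+ 2 * D)) =
  (1 + eta) * (lam ^+ 2 * (Q + su2) - 2 * t * lam * Q + t ^+ 2 * Q) +
    (1 + eta^-1) * (t ^+ 2 * D).
  by field; rewrite !gt_eqF.
suff -> : lam ^+ 2 * (Q + su2) - 2 * t * lam * Q + t ^+ 2 * Q =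
  (1 - t) ^+ 2 * Q' + t ^+ 2 * N' by [].
by rewrite /lam /Q' /N'; field; rewrite gt_eqF.
Qed.

End Converse.

Unset Implicit Arguments.
Set Strict Implicit.
Set Printing Implicit Defensive.

Theorem theorem3 (R : realType) (P Q N su2 : R)
  (P0 : 0 < P) (Q0 : 0 < Q) (N0 : 0 < N) (su20 : 0 <= su2)
  (d : measure_display) (Omega : measurableType d) (Pr : probability Omega R)
  (S U Z : nat -> {RV Pr >-> R})
  (channel : gaussian_channel S U Z Q N su2)
  (r D : R) (r0 : 0 <= r)
  (M : forall n : nat, Omega -> 'I_(msg_count r n))
  (message : forall n : nat, uniform_message S U Z n (M n))
  (rD_achievable : achievable S U Z P M D) :
  let lam := Q / (Q + su2) in
  let Q' := Q ^+ 2 / (Q + su2) in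
  let N' := Q * su2 / (Q + su2) in
  exists rbar : R,
    [/\ 0 <= rbar <= Num.sqrt (P * (Q + su2)),
        r <= 2^-1 * log2 ((su2 * (N + P + Q) + Q * (N + P) - rbar ^+ 2)
                          / ((Q + su2) * (N + N'))) &
        distortion_bound Q' N'
          (Q' * (N + N') / (P + Q + N + 2 * lam * rbar) * (2 `^ (2 * r))) <= D].
Proof.
exact: (converse_bounds P0 Q0 N0 su20 channel r0 message rD_achievable).
Qed.
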